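(* Let $\{X_n,n\ge 0\}$ be a nonhomogeneous Markov chain on a probability space $(\Omega,\mathcal F,\mathbb P)$, taking values in $S=\{1,2,\ldots\}$, with initial distribution $\mu^{(0)}=(\mu(1),\mu(2),\ldots)$ and transition matrices $P_n=(p_n(i,j))_{i,j\in S}$, $n\ge 1$, where $p_n(i,j)=\mathbb P(X_n=j\mid X_{n-1}=i)$. Let $P=(p(i,j))_{i,j\in S}$ be a periodic strongly ergodic stochastic matrix, and let $\pi=(\pi(1),\pi(2),\ldots)$ be its stationary distribution, $\pi P=\pi$, $\sum_i\pi(i)=1$. Assume that $$\lim_{n\to\infty}\sup_{m\ge 0}\frac1n\sum_{k=1}^{n}\|P_{k+m}-P\|=0\qquad\text{and}\qquad \lim_{n\to\infty}\frac{\sum_{k=1}^{n}\delta(P_k)}{\sqrt n}=0 .$$ Let $(a(n))_{n\ge1}$ be a sequence of positive reals with $\lim_{n\to\infty} a(n)/\sqrt n=\infty$ and $\lim_{n\to\infty}a(n)/n=0$. Put $$\Gamma_n(B)=\frac1{a(n)}\big(\delta_{X_1}(B)+\cdots+\delta_{X_n}(B)\big),\quad B\in\mathscr B(\mathbb R),\qquad c_n\{A\}=\mathbb P\{\Gamma_n-E(\Gamma_n)\in A\},\quad A\subset M(\mathbb R).$$ Then $\{c_n,n\ge 1\}$ satisfies the moderate deviation principle in $(M(\mathbb R),\tau)$ with speed $a^2(n)/n$ and good rate function $$I_\mu(\nu)=\sup_{f\in\mathscr B_b(\mathbb R)}\Big\{\langle f,\nu\rangle-\frac12\sum_{i\in S}\pi(i)\Big[f^2(i)-\Big(\sum_{j\in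 S}f(j)p(i,j)\Big)^2\Big]\Big\},\quad \nu\in M(\mathbb R);$$ that is, $I_\mu$ is a good rate function on $(M(\mathbb R),\tau)$, for every $\tau$-open set $G\subset M(\mathbb R)$, $$\liminf_{n\to\infty}\frac{n}{a^2(n)}\log c_n\{G\}\ge-\inf_{\nu\in G}I_\mu(\nu),$$ and for every $\tau$-closed set $F\subset M(\mathbb R)$, $$\limsup_{n\to\infty}\frac{n}{a^2(n)}\log c_n\{F\}\le-\inf_{\nu\in F}I_\mu(\nu).$$
   Context: For a matrix $A=(a_{ij})_{i,j\in S}$, $\|A\|=\sup_{i\in S}\sum_{j\in S}|a_{ij}|$. For a stochastic matrix $Q=(q(i,j))_{i,j\in S}$, $\delta(Q)=\sup_{i,k\in S}\sum_{j=1}^\infty[q(i,j)-q(k,j)]^+$, where $[a]^+=\max\{0,a\}$. An irreducible stochastic matrix $P$ on $S$ of period $d\ge1$ partitions $S$ into $d$ disjoint cyclic classes $C_0,\ldots,C_{d-1}$, and $P^d$ restricts to stochastic matrices $T_l$ on $C_l$, $0\le l\le d-1$. $P$ is called periodic strongly ergodic if it is irreducible with some period $d\ge 1$ and each $T_l$ is strongly ergodic, i.e. there is a stochastic matrix $Q_l$ on $C_l$ with all rows identical such that $\|T_l^n-Q_l\|\to0$ as $n\to\infty$ (same norm, over $C_l$). $\mathscr B(\mathbb R)$ is the Borel $\sigma$-field of $\mathbb R$; $\mathscr B_b(\mathbb R)$ is the linear space of bounded (Borel) measurable real functions on $\mathbb R$; $M(\mathbb R)$ is the space of finite signed measures on $\mathbb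 R$; $\langle f,\nu\rangle=\int_{\mathbb R}f(x)\,\nu(dx)$. $\tau$ is the topology on $M(\mathbb R)$ generated by the maps $\nu\mapsto\langle f,\nu\rangle$, $f\in\mathscr B_b(\mathbb R)$, and $M(\mathbb R)$ carries the $\sigma$-field generated by these maps. $\delta_x$ is the Dirac measure at $x$ (not to be confused with the coefficient $\delta(Q)$ of a stochastic matrix); $S$ is regarded as a subset of $\mathbb R$. $E$ is expectation under $\mathbb P$, and $E(\Gamma_n)$ is the measure $B\mapsto E[\Gamma_n(B)]$. A good rate function is a function into $[0,\infty]$ whose sublevel sets $\{\nu: I_\mu(\nu)\le l\}$, $l\in(0,\infty)$, are $\tau$-compact. Conventions: $\log 0=-\infty$, $\inf\emptyset=+\infty$. *)

(* Defs.v *)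
From HB Require Import structures.
From mathcomp Require Import all_boot all_order all_algebra.
From mathcomp Require Import all_classical all_reals all_analysis.
Import Order.TTheory GRing.Theory Num.Theory.
Import numFieldNormedType.Exports.
Set Implicit Arguments.
Unset Strict Implicit.
Unset Printing Implicit Defensive.
Local Open Scope classical_set_scope.
Local Open Scope ring_scope.

Definition states : set nat := [set i | (0 < i)%N].

(* A matrix indexed by C `<=` states is a function nat -> nat -> R of which
   only the entries in C x C are used. *)
Section matrices.
Context {R : realType}.
Implicit Types (C : set nat) (A Q : nat -> nat -> R).

(* Only used for absolutely convergent sums, so the order of summation is
   immaterial. *)
Definition rsum C (u : nat -> R) : R :=
  limn (fun n => \sum_(0 <= k < n | k \in C) u k).

Definition mnorm C A : \bar R :=
  ereal_sup [set (\esum_(j in C) `|A i j|%:E)%E | i in C].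

Definition stochastic C A : Prop :=
  (forall i j, C i -> C j -> 0 <= A i j) /\
  (forall i, C i -> (\esum_(j in C) (A i j)%:E = 1)%E).

Definition ergodic_coef C Q : \bar R :=
  ereal_sup [set (\esum_(j in C) (Num.max 0 (Q i j - Q k j))%:E)%E
            | i in C & k in C].

Fixpoint mxpow C A (n : nat) : nat -> nat -> R :=
  if n is m.+1 then fun i j => rsum C (fun k => mxpow C A m i k * A k j)
  else fun i j => (i == j)%:R.

Definition strongly_ergodic C A : Prop :=
  exists Q, [/\ stochastic C Q,
    (forall i k j, C i -> C k -> C j -> Q i j = Q k j) &
    mnorm C (fun i j => mxpow C A n i j - Q i j) @[n --> \oo] --> 0%E].

Definition irreducible_on C A : Prop :=
  forall i j, C i -> C j -> exists n, (0 < n)%N /\ 0 < mxpow C A n i j.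

(* d is the gcd of the set of return times of each state. *)
Definition has_period C A (d : nat) : Prop :=
  (0 < d)%N /\
  forall i, C i -> forall m : nat,
    (m %| d)%N <->
    (forall n, (0 < n)%N -> 0 < mxpow C A n i i -> (m %| n)%N).

Definition cyclic_classes C A (d : nat) (K : 'I_d -> set nat) : Prop :=
  [/\ forall l, K l !=set0,
      trivIset setT K,
      \bigcup_l K l = C &
      forall l i j, K l i -> C j -> 0 < A i j -> K (ordS l) j].

Definition periodic_strongly_ergodic C A : Prop :=
  irreducible_on C A /\
  exists (d : nat) (K : 'I_d -> set nat),
    [/\ has_period C A d,
        cyclic_classes C A K &
        forall l, strongly_ergodic (K l) (mxpow C A d)].

Definition stationary C A (p : nat -> R) : Prop :=
  [/\ forall i, C i -> 0 <= p i,
      (\esum_(i in C) (p i)%:E = 1)%E &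
      forall j, C j -> (\esum_(i in C) (p i * A i j)%:E = (p j)%:E)%E].

End matrices.

Section markov_chains.
Context {R : realType} d {Omega : measurableType d} (P : probability Omega R).

Definition cond_prob (A B : set Omega) : R := fine (P (A `&` B)) / fine (P B).

(* Conditional probabilities are only constrained when the conditioning event
   has positive probability. *)
Definition is_markov_chain (X : nat -> {RV P >-> nat}) (mu : nat -> R)
    (p : nat -> nat -> nat -> R) : Prop :=
  let past (x : nat -> nat) n :=
    [set w | forall k, (k <= n)%N -> X k w = x k] in
  [/\ forall n w, states (X n w),
      forall i, states i -> P [set w | X 0%N w = i] = (mu i)%:E,
      forall n, (0 < n)%N -> stochastic states (p n),
      forall n i j, states i -> states j -> (0 < P [set w | X n w = i])%E ->
        cond_prob [set w | X n.+1 w = j] [set w | X n w = i] = p n.+1 i j &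
      forall n (x : nat -> nat), (forall k, states (x k)) ->
        (0 < P (past x n))%E ->
        cond_prob [set w | X n.+1 w = x n.+1] (past x n) =
        cond_prob [set w | X n.+1 w = x n.+1] [set w | X n w = x n] ].

End markov_chains.

(* A charge is a function on all sets of reals which is only constrained on
   Borel sets. Two charges equal on Borel sets have the same pairings, hence
   the same tau-neighbourhoods. *)
Definition signed_measures (R : realType) : Type := {charge set R -> \bar R}.

HB.instance Definition _ (R : realType) := gen_eqMixin (signed_measures R).
HB.instance Definition _ (R : realType) := gen_choiceMixin (signed_measures R).

Definition bounded_borel (R : realType) : Type :=
  {f : R -> R | measurable_fun setT f /\ bounded_fun f}.

Section pairing.
Context {R : realType}.

Lemma hahn_ex (nu : {charge set R -> \bar R}) :
  exists PN : set R * set R, hahn_decomposition nu PN.1 PN.2.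
Proof. by have [P [N h]] := Hahn_decomposition nu; exists (P, N). Qed.

(* The value does not depend on the Hahn decomposition. *)
Definition pairing (f : R -> R) (nu : {charge set R -> \bar R}) : R :=
  let h := projT2 (cid (hahn_ex nu)) in
  \int[jordan_pos h]_x f x - \int[jordan_neg h]_x f x.

End pairing.

Definition tau_topology (R : realType) : Type :=
  sup_topology (fun f : bounded_borel R => Topological.on
    (initial_topology (fun nu : signed_measures R => pairing (sval f) nu))).

HB.instance Definition _ (R : realType) := Topological.on (tau_topology R).

Section charge_helpers.
Context {R : realType} {d} {T : measurableType d}.
Local Open Scope ereal_scope.

Lemma charge_sum (mu : nat -> {charge set T -> \bar R}) (n : nat) :
  exists nu : {charge set T -> \bar R},
    forall A, \sum_(1 <= k < n.+1) mu k A = nu A.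
Proof.
elim: n => [|n [nu nuE]].
  by exists (@czero d T R) => A; rewrite big_geq.
exists (cadd nu (mu n.+1)) => A.
by rewrite big_nat_recr//= nuE.
Qed.

Variables (f : set T -> \bar R) (nu : {charge set T -> \bar R}).
Hypothesis fE : forall A, measurable A -> f A = nu A.

Lemma charge_ext0 : f set0 = 0. Proof. by rewrite fE// charge0. Qed.

Lemma charge_ext_fin A : measurable A -> f A \is a fin_num.
Proof. by move=> mA; rewrite fE// fin_num_measure. Qed.

Lemma charge_ext_sigma : semi_sigma_additive f.
Proof.
move=> F mF tF mUF; rewrite fE//.
under eq_fun do under eq_bigr do rewrite fE//.
exact: charge_semi_sigma_additive.
Qed.

End charge_helpers.

Section empirical_measure.
Context {R : realType}.
Local Open Scope ereal_scope.
Variables (a : nat -> R) (x : nat -> nat) (n : nat).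

Definition empirical (B : set R) : \bar R :=
  ((a n)^-1)%:E * \sum_(1 <= k < n.+1) \d_((x k)%:R : R) B.

Let empirical_ex : exists nu : {charge set R -> \bar R},
  forall A, measurable A -> empirical A = nu A.
Proof.
have [nu nuE] := charge_sum
  (fun k => charge_of_finite_measure (\d_((x k)%:R : R))
     : {charge set R -> \bar R}) n.
by exists (cscale (a n)^-1 nu) => A _; congr *%E; exact: nuE.
Qed.

Let empirical0 : empirical set0 = 0.
Proof. by have [nu h] := empirical_ex; exact: (charge_ext0 h). Qed.

Let empirical_fin A : measurable A -> empirical A \is a fin_num.
Proof. by have [nu h] := empirical_ex; exact: (charge_ext_fin h). Qed.

Let empirical_sigma : semi_sigma_additive empirical.
Proof. by have [nu h] := empirical_ex; exact: (charge_ext_sigma h). Qed.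

HB.instance Definition _ := isCharge.Build _ _ _ empirical
  empirical0 empirical_fin empirical_sigma.

End empirical_measure.

Section mean_empirical_measure.
Context {R : realType} d {Omega : measurableType d} (P : probability Omega R).
Local Open Scope ereal_scope.
Variables (X : nat -> {RV P >-> nat}) (a : nat -> R) (n : nat).

Definition mean_empirical (B : set R) : \bar R :=
  'E_P[fun w => fine (empirical a (fun k => X k w) n B)].

Let Xr k : Omega -> R := fun w => (X k w)%:R.

Let measurable_Xr k : measurable_fun [set: Omega] (Xr k).
Proof. by apply: (measurableT_comp (f := fun i : nat => i%:R : R)). Qed.

HB.instance Definition _ k := isMeasurableFun.Build _ _ _ _ (Xr k)
  (measurable_Xr k).

Let mean_empirical_ex : exists nu : {charge set R -> \bar R},
  forall A, measurable A -> mean_empirical A = nu A.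
Proof.
have [nu nuE] := charge_sum
  (fun k => charge_of_finite_measure (distribution P (Xr k))
     : {charge set R -> \bar R}) n.
exists (cscale (a n)^-1 nu) => A mA.
have mXA k : measurable (Xr k @^-1` A).
  by rewrite -[X in measurable X]setTI; exact: measurable_Xr.
have intX k : P.-integrable setT (EFin \o \1_(Xr k @^-1` A)).
  exact: integrable_indic.
rewrite /mean_empirical unlock.
transitivity (\int[P]_w (((a n)^-1)%:E *
    \sum_(1 <= k < n.+1) (\1_(Xr k @^-1` A) w)%:E)).
  by apply: eq_integral => w _; rewrite /empirical /dirac sumEFin -EFinM.
rewrite integralZl//; last first.
  by apply: integrable_sum => // k _; exact: intX.
congr *%E; rewrite integral_sum// -[RHS]nuE.
by apply: eq_bigr => k _; rewrite integral_indic// setIT.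
Qed.

Let mean_empirical0 : mean_empirical set0 = 0.
Proof. by have [nu h] := mean_empirical_ex; exact: (charge_ext0 h). Qed.

Let mean_empirical_fin A : measurable A -> mean_empirical A \is a fin_num.
Proof. by have [nu h] := mean_empirical_ex; exact: (charge_ext_fin h). Qed.

Let mean_empirical_sigma : semi_sigma_additive mean_empirical.
Proof. by have [nu h] := mean_empirical_ex; exact: (charge_ext_sigma h). Qed.

HB.instance Definition _ := isCharge.Build _ _ _ mean_empirical
  mean_empirical0 mean_empirical_fin mean_empirical_sigma.

End mean_empirical_measure.

(* The event is measurable for every A: it only depends on the values of the
   discrete random variables X 1, ..., X n. *)
Definition deviation_prob (R : realType) d (Omega : measurableType d)
    (P : probability Omega R) (X : nat -> {RV P >-> nat}) (a : nat -> R)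
    (n : nat) (A : set (tau_topology R)) : \bar R :=
  P [set w | A (cadd (empirical a (fun k => X k w) n)
                     (copp (mean_empirical X a n)))].

Section moderate_deviations.
Context {R : realType}.
Local Open Scope ereal_scope.

Definition good_rate_function (M : topologicalType) (I : M -> \bar R) : Prop :=
  (forall nu, 0 <= I nu) /\
  (forall l : R, (0 < l)%R -> compact [set nu | I nu <= l%:E]).

Definition satisfies_mdp (M : topologicalType) (c : nat -> set M -> \bar R)
    (speed : nat -> R) (I : M -> \bar R) : Prop :=
  [/\ good_rate_function I,
      forall G : set M, open G ->
        - ereal_inf [set I nu | nu in G] <=
        limn_einf (fun n => ((speed n)^-1)%:E * lne (c n G)) &
      forall F : set M, closed F ->
        limn_esup (fun n => ((speed n)^-1)%:E * lne (c n F)) <=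
        - ereal_inf [set I nu | nu in F]].

Definition rate_function (P : nat -> nat -> R) (p : nat -> R) (nu : tau_topology R) :
    \bar R :=
  ereal_sup [set
    (pairing (sval f) nu - 2^-1 * rsum states (fun i =>
       p i * (sval f i%:R ^+ 2 -
              rsum states (fun j => sval f j%:R * P i j) ^+ 2)))%:E
    | f in [set: bounded_borel R]].

End moderate_deviations.

(* Main.v *)
Require Import Defs.
From HB Require Import structures.
From mathcomp Require Import all_boot all_order all_algebra.
From mathcomp Require Import all_classical all_reals all_analysis.
From mathcomp Require Import measurable_realfun lra ring.
Import Order.TTheory GRing.Theory Num.Theory.
Import numFieldNormedType.Exports.
Set Implicit Arguments.
Unset Strict Implicit.
Unset Printing Implicit Defensive.
Local Open Scope classical_set_scope.
Local Open Scope ring_scope.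

(* Replacing [P k] by [P] on average, the second assumption forces
   [ergodic_coef P = 0]: all rows of [P] equal [pi], the chain is close to an
   i.i.d. sequence, and the quadratic functional in [I_mu] is the variance of
   [f] under [pi].

   Cumulants.  With [b = a n / n], one step of the chain multiplies the mean of
   [exp (b * sum (f (X k) - E f (X k)))] by [1 + b^2 V / 2] up to an error of
   order [b * delta (P k) + b^2 * |P k - P| + b^3]; summed over [k <= n] this is
   [o(a n ^ 2 / n)], so the normalised cumulants tend to [V / 2].

   Compactness.  Along an ultrafilter of charges with [<f, nu> <= V f / 2 + l]
   for all [f], the pairings converge to a linear functional [L] with
   [L f ^ 2 <= 2 l V f]; this bound makes [B |-> L 1_B] sigma-additive, so the
   ultrafilter converges to a charge of rate at most [l].  This gives both
   compactness of sublevel sets and, by contraposition, a cover of any closed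
   set of rate above [l] by finitely many half-spaces, to which Chebyshev's
   inequality applies; no exponential tightness is needed.

   Lower bound.  If [g] nearly maximises the dual problem at [nu], then
   [<f, nu>] is close to the covariance of [f] and [g], and tilting by [g]
   concentrates the centred empirical measure near [nu]. *)

(** * Means under probability vectors *)

(** When the rate at [nu] is finite, the formal maximiser of the dual problem is the density of [nu]
    with respect to [pi]. It may be unbounded, while only bounded functions are admissible; the
    lower bound therefore works with a near maximiser, whose first-order condition holds up to an
    error tuned to the neighbourhood of [nu]. The three error terms match the assumptions: divided
    by [a n ^ 2 / n], the sums of [b * delta (P k)], [b^2 * |P k - P|] and [b^3] over [k <= n]
    become the sum of [delta (P k)] over [a n], an average of [|P k - P|], and [b]. The first is
    linear in [b] because a variable centred by its unconditional mean is not centred given the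
    past. Histories of the chain take countably many values, so conditioning on the past is a sum
    over histories and every event about the empirical measure is measurable. *)

Lemma eq_cvg_to {R : realType} (T : Type) (F : set_system T) (u v : T -> R)
  (l : R) : u =1 v -> u @ F --> l -> v @ F --> l.
Proof. by move=> /funext ->. Qed.

Section probability_vectors.
Context {R : realType}.
Implicit Types (w f g : nat -> R).

Definition probability_vector w : Prop :=
  (forall i, states i -> 0 <= w i) /\
  (\esum_(i in states) (w i)%:E = 1)%E.

Definition mean w f : R := rsum states (fun i => w i * f i).

Lemma esum_partial_sum (u : nat -> R) n :
  ((\sum_(0 <= k < n | k \in states) `|u k|)%:E <=
   \esum_(k in states) `|u k|%:E)%E.
Proof.
have u0 : forall k, k \in states -> (0 <= (`|u k|)%:E)%E by move=> k _; rewrite lee_fin.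
have -> : (states = [set x | x \in states])%classic.
  by apply/seteqP; split=> x /=; rewrite inE.
rewrite -nneseries_esum//.
have -> : [set x | x \in states]%classic = states :> set nat.
  by apply/seteqP; split=> x /=; rewrite inE.
rewrite -sumEFin.
by apply: nneseries_lim_ge => k _ ks; exact: u0.
Qed.

Lemma esum_partial_cvg (u : nat -> R) (l : R) :
  (forall i, states i -> 0 <= u i) -> (\esum_(i in states) (u i)%:E = l%:E)%E ->
  \sum_(0 <= k < n | k \in states) u k @[n --> \oo] --> l.
Proof.
move=> u0 ul.
suff : (\sum_(0 <= k < n | k \in states) u k)%:E @[n --> \oo] --> (l%:E : \bar R).
  by move=> /fine_cvgP[].
rewrite -ul.
have -> : (states = [set x | x \in states])%classic.
  by apply/seteqP; split=> x /=; rewrite inE.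
rewrite -nneseries_esum; last by move=> n /set_mem/u0; rewrite lee_fin.
have -> : [set x | x \in states]%classic = states :> set nat.
  by apply/seteqP; split=> x /=; rewrite inE.
have := @is_cvg_nneseries R (EFin \o u) (fun k => k \in states) 0%N.
move=> /(_ _)/cvg_ex[|v uv].
  by move=> n _ /set_mem/u0; rewrite lee_fin.
rewrite (cvg_lim _ uv)//; apply: cvg_trans uv; apply: near_eq_cvg.
by apply: nearW => n; rewrite sumEFin.
Qed.

Lemma probability_vector_cvg w : probability_vector w ->
  \sum_(0 <= k < n | k \in states) w k @[n --> \oo] --> (1 : R).
Proof. by move=> [w0 w1]; exact: esum_partial_cvg. Qed.

(** [rsum] is a bare [limn], so [mean] carries information only once its partial sums converge.
    Comparison with [M * w k] gives absolute convergence. *)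
Lemma mean_cvg w f (M : R) : probability_vector w -> (forall i, `|f i| <= M) ->
  \sum_(0 <= k < n | k \in states) w k * f k @[n --> \oo] --> mean w f.
Proof.
move=> pw fM.
have [w0 _] := pw.
suff : cvgn (fun n => \sum_(0 <= k < n | k \in states) w k * f k).
  by move=> /cvg_ex[l ul]; rewrite /mean /rsum (cvg_lim _ ul).
pose u k := if k \in states then w k * f k else 0.
pose v k := if k \in states then M * w k else 0.
have -> : (fun n => \sum_(0 <= k < n | k \in states) w k * f k) = series u.
  by apply/funext => n; rewrite /series/= big_mkcond.
apply: normed_cvg.
apply: (@series_le_cvg _ _ v) => /=.
- by [].
- move=> n; rewrite /v; case: ifPn => // /set_mem/w0 wn.
  by rewrite mulr_ge0// (le_trans _ (fM 0%N)).
- move=> n; rewrite /u /v; case: ifPn; last by rewrite normr0.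
  by move=> /set_mem/w0 wn; rewrite normrM mulrC (ger0_norm wn) ler_wpM2r.
- have -> : series v = (fun n => M * \sum_(0 <= k < n | k \in states) w k).
    by apply/funext => n; rewrite /series/= mulr_sumr [RHS]big_mkcond.
  by apply: is_cvgM; [exact: is_cvg_cst|apply/cvg_ex; exists 1; exact: probability_vector_cvg].
Qed.

Section properties.
Variables (w : nat -> R) (pw : probability_vector w).

Lemma mean_lin f g c (Mf Mg : R) : (forall i, `|f i| <= Mf) ->
  (forall i, `|g i| <= Mg) ->
  mean w (fun i => c * f i + g i) = c * mean w f + mean w g.
Proof.
move=> fM gM.
rewrite {1}/mean /rsum; apply: cvg_lim => //.
apply: (eq_cvg_to _ (cvgD (cvgM (cvg_cst c) (mean_cvg pw fM)) (mean_cvg pw gM))).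
move=> n; rewrite !fctE /= mulr_sumr -big_split/=; apply: eq_bigr => k _; ring.
Qed.

Lemma mean_cst c : mean w (fun=> c) = c.
Proof.
rewrite {1}/mean /rsum; apply: cvg_lim => //.
rewrite -[X in _ --> X]mul1r.
apply: (eq_cvg_to _ (cvgM (probability_vector_cvg pw) (cvg_cst c))) => n.
by rewrite /= mulr_suml.
Qed.

Lemma mean_le f g (Mf Mg : R) : (forall i, `|f i| <= Mf) ->
  (forall i, `|g i| <= Mg) -> (forall i, states i -> f i <= g i) ->
  mean w f <= mean w g.
Proof.
move=> fM gM fg.
apply: (ler_cvg_to (mean_cvg pw fM) (mean_cvg pw gM)).
apply: nearW => n; apply: ler_sum => k /set_mem ks.
by apply: ler_wpM2l; [exact: pw.1|exact: fg].
Qed.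

Lemma mean_norm f (M : R) : (forall i, `|f i| <= M) -> `|mean w f| <= M.
Proof.
move=> fM.
have fl i : - M <= f i by have := fM i; rewrite ler_norml => /andP[].
have fr i : f i <= M by have := fM i; rewrite ler_norml => /andP[].
have cM (c : R) : forall i : nat, `|c| <= `|c| by [].
rewrite ler_norml; apply/andP; split.
  by have := mean_le (cM (- M)) fM (fun i _ => fl i); rewrite mean_cst.
by have := mean_le fM (cM M) (fun i _ => fr i); rewrite mean_cst.
Qed.

End properties.

(** The form in which [ergodic_coef] and [mnorm] act on the chain: both bound the partial sums of
    the distance between two rows. *)
Lemma mean_diff w w' f (M D : R) : probability_vector w -> probability_vector w' ->
  (forall i, `|f i| <= M) ->
  (forall n, \sum_(0 <= k < n | k \in states) `|w k - w' k| <= D) ->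
  `|mean w f - mean w' f| <= M * D.
Proof.
move=> pw pw' fM wD.
have M0 : 0 <= M by apply: le_trans (fM 0%N).
apply: (cvgr_to_le (cvg_norm (cvgB (mean_cvg pw fM) (mean_cvg pw' fM)))).
apply: nearW => n; rewrite !fctE /= -sumrB (le_trans (ler_norm_sum _ _ _))//.
apply: le_trans (ler_wpM2l M0 (wD n)); rewrite mulr_sumr; apply: ler_sum => k _.
by rewrite -mulrBl normrM mulrC ler_wpM2r.
Qed.

Lemma mean_ltn w N : probability_vector w ->
  mean w (fun i => (i < N)%N%:R) = \sum_(0 <= k < N | k \in states) w k.
Proof.
move=> pw; rewrite /mean /rsum; apply: cvg_lim => //.
apply: cvg_near_cst; near=> n.
have Nn : (N <= n)%N by near: n; exact: nbhs_infty_ge.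
rewrite (big_cat_nat (leq0n N) Nn)/= [X in _ + X]big1_seq ?addr0; last first.
  move=> i; rewrite mem_index_iota => /andP[_ /andP[Ni _]].
  by rewrite ltnNge Ni mulr0.
rewrite big_nat_cond [RHS]big_nat_cond; apply: eq_bigr => i /andP[/andP[_ iN] _].
by rewrite iN mulr1.
Unshelve. all: by end_near. Qed.

(** Dominated convergence: the indices below some [N] are eventually all in the zero set of [f n],
    and the indices from [N] on carry little mass. *)
Lemma mean_cvg0 w (f : nat -> nat -> R) (M : R) : probability_vector w ->
  (forall n i, `|f n i| <= M) -> (forall i, \forall n \near \oo, f n i = 0) ->
  mean w (f n) @[n --> \oo] --> (0 : R).
Proof.
move=> pw fM f0; have M0 : 0 <= M by apply: le_trans (fM 0%N 0%N).
apply/cvgrPdist_le => e e0.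
have eM : 0 < e / (M + 1) by rewrite divr_gt0// ltr_wpDl.
have /cvgrPdist_le/(_ _ eM)[N _ /(_ N (leqnn N))/= hN] := probability_vector_cvg pw.
have f0N : \forall n \near \oo, forall i, (i < N)%N -> f n i = 0.
  elim: (N) => [|K ih]; first by apply: nearW.
  near=> n => i; rewrite ltnS leq_eqVlt => /predU1P[->|]; first by near: n.
  by move: i; near: n.
near=> n.
have fn0 : forall i, (i < N)%N -> f n i = 0 by near: n.
rewrite sub0r normrN.
(* [g] is [M] times the indicator of [i >= N], written in the shape required by [mean_lin]. *)
pose g i := (- M) * (i < N)%N%:R + M.
have gM i : `|g i| <= M.
  by rewrite /g; case: (i < N)%N; rewrite ?mulr1 ?mulr0 ?addNr ?add0r ?normr0// ger0_norm.
have fg i : `|f n i| <= g i.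
  rewrite /g; case: ltnP => iN; last by rewrite mulr0 add0r.
  by rewrite fn0// normr0 mulr1 addNr.
have b1 : forall i : nat, `|(i < N)%N%:R : R| <= 1.
  by move=> i; case: (i < N)%N; rewrite ?normr1 ?normr0.
have mg : mean w g = M * (1 - \sum_(0 <= k < N | k \in states) w k).
  rewrite /g (mean_lin pw (- M) b1 (fun _ => lexx `|M|)).
  by rewrite mean_ltn// mean_cst//; ring.
have gM' i : `|- 1 * g i + 0| <= M by rewrite mulN1r addr0 normrN.
have := mean_le pw (fM n) gM (fun i _ => le_trans (ler_norm _) (fg i)).
have fg' i : states i -> -1 * g i + 0 <= f n i.
  by move=> _; have := fg i; rewrite mulN1r addr0 ler_norml => /andP[].
have := mean_le pw gM' (fM n) fg'.
rewrite (mean_lin pw _ gM (fun _ => lexx `|0|)) mean_cst// mulN1r addr0 => h1 h2.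
apply: (@le_trans _ _ (mean w g)); first by rewrite ler_norml h1 h2.
rewrite mg (le_trans (ler_wpM2l M0 (le_trans (ler_norm _) hN)))//.
rewrite mulrA ler_pdivrMr; last by rewrite ltr_wpDl.
by rewrite mulrC ler_pM2l// lerDl.
Unshelve. all: by end_near. Qed.

Lemma eq_rsum (C : set nat) (u v : nat -> R) : (forall k, C k -> u k = v k) ->
  rsum C u = rsum C v.
Proof.
move=> uv; rewrite /rsum; congr (limn _); apply/funext => n.
by apply: eq_bigr => k /set_mem; exact: uv.
Qed.

Definition covar w f g : R := mean w (fun i => f i * g i) - mean w f * mean w g.

Section covariance.
Variables (w : nat -> R) (pw : probability_vector w).
Definition nbounded f := exists M : R, forall i, `|f i| <= M.

Lemma nboundedM f g : nbounded f -> nbounded g -> nbounded (fun i => f i * g i).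
Proof.
move=> [M fM] [N gN]; exists (M * N) => i.
by rewrite normrM ler_pM.
Qed.

Lemma nbounded_lin c f g : nbounded f -> nbounded g ->
  nbounded (fun i => c * f i + g i).
Proof.
move=> [M fM] [N gN]; exists (`|c| * M + N) => i.
by rewrite (le_trans (ler_normD _ _))// lerD// normrM ler_wpM2l.
Qed.

Lemma meanP c f g : nbounded f -> nbounded g ->
  mean w (fun i => c * f i + g i) = c * mean w f + mean w g.
Proof. by move=> [M fM] [N gN]; exact: mean_lin fM gN. Qed.

Lemma covarC f g : covar w f g = covar w g f.
Proof.
rewrite /covar [in RHS]mulrC; congr (mean _ _ - _).
by apply/funext => i; rewrite mulrC.
Qed.

Lemma covar_linl c f g h : nbounded f -> nbounded g -> nbounded h ->
  covar w (fun i => c * f i + g i) h = c * covar w f h + covar w g h.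
Proof.
move=> bf bg bh; rewrite /covar meanP//.
have -> : (fun i => (c * f i + g i) * h i) =
          (fun i => c * (f i * h i) + g i * h i) by apply/funext => i; ring.
by rewrite meanP; [ring|exact: nboundedM..].
Qed.

Lemma covar_linr c f g h : nbounded f -> nbounded g -> nbounded h ->
  covar w h (fun i => c * f i + g i) = c * covar w h f + covar w h g.
Proof. by move=> ? ? ?; rewrite covarC covar_linl// ![covar w h _]covarC. Qed.

Lemma variance_lin c f g : nbounded f -> nbounded g ->
  covar w (fun i => c * f i + g i) (fun i => c * f i + g i) =
  c ^+ 2 * covar w f f + 2 * c * covar w f g + covar w g g.
Proof.
move=> bf bg; rewrite covar_linl ?covar_linr//; last exact: nbounded_lin.
by rewrite (covarC g f); ring.
Qed.

Lemma variance_ge0 f : nbounded f -> 0 <= covar w f f.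
Proof.
move=> bf; pose m := mean w f.
have b1 : nbounded (fun=> 1) by exists 1 => _; rewrite normr1.
have bcst c : nbounded (fun=> c) by exists `|c|.
have bh : nbounded (fun i => (-m) * 1 + f i) by exact: nbounded_lin.
(* The variance is the mean of the square of [f] minus its mean [m]. *)
have -> : covar w f f = mean w (fun i => ((-m) * 1 + f i) * ((-m) * 1 + f i)).
  have -> : (fun i => (- m * 1 + f i) * (- m * 1 + f i)) =
    (fun i => (- (2 * m)) * f i + (1 * (f i * f i) + m ^+ 2)).
    by apply/funext => i; ring.
  rewrite meanP//; last by apply: nbounded_lin => //; exact: nboundedM.
  rewrite meanP//; last exact: nboundedM.
  by rewrite mean_cst// /covar -/m; ring.
have [M hM] := nboundedM bh bh.
have := mean_le pw (fun=> lexx `|0|) hM (fun i _ => sqr_ge0 _).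
by rewrite mean_cst.
Qed.

Lemma variance_le f (M : R) : (forall i, `|f i| <= M) -> covar w f f <= M ^+ 2.
Proof.
move=> fM; rewrite /covar lerBlDr ler_wpDr ?sqr_ge0//.
have ffM i : `|f i * f i| <= M ^+ 2 by rewrite normrM expr2 ler_pM.
exact: le_trans (ler_norm _) (mean_norm pw ffM).
Qed.

Lemma variance_scale c f : nbounded f ->
  covar w (fun i => c * f i) (fun i => c * f i) = c ^+ 2 * covar w f f.
Proof.
move=> bf; have b0 : nbounded (fun=> 0) by exists 0 => _; rewrite normr0.
have := variance_lin c bf b0.
have -> : (fun i => c * f i + 0) = (fun i => c * f i).
  by apply/funext => i; rewrite addr0.
move=> ->; rewrite /covar.
have -> : (fun i => f i * 0) = (fun=> 0) by apply/funext => i; rewrite mulr0.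
have -> : (fun=> 0 * 0) = (fun=> 0) :> (nat -> R).
  by apply/funext => i; rewrite mulr0.
by rewrite !mean_cst//; ring.
Qed.

End covariance.
End probability_vectors.

(** * Bounded linear functionals on bounded measurable functions *)

Section bounded_measurable.
Context {d} {T : measurableType d} {R : realType}.
Implicit Types (f g : T -> R) (L : (T -> R) -> R).

Definition bounded_measurable f : Prop :=
  measurable_fun setT f /\ exists M, forall x, `|f x| <= M.

Lemma bounded_measurable_cst c : bounded_measurable (fun=> c).
Proof. by split; [exact: measurable_cst|exists `|c|]. Qed.

Lemma bounded_measurable_indic A : measurable A -> bounded_measurable \1_A.
Proof.
move=> mA; split; first exact: measurable_indic.
by exists 1 => x; rewrite indicE; case: (_ \in _); rewrite ?normr1 ?normr0.
Qed.

Lemma bounded_measurable_lin c f g :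
  bounded_measurable f -> bounded_measurable g ->
  bounded_measurable (fun x => c * f x + g x).
Proof.
move=> [mf [Mf fM]] [mg [Mg gM]]; split.
  by apply: measurable_funD => //; apply: measurable_funM.
exists (`|c| * Mf + Mg) => x; rewrite (le_trans (ler_normD _ _))// lerD//.
by rewrite normrM ler_wpM2l.
Qed.

Lemma bounded_measurableM f g :
  bounded_measurable f -> bounded_measurable g ->
  bounded_measurable (fun x => f x * g x).
Proof.
move=> [mf [Mf fM]] [mg [Mg gM]]; split; first exact: measurable_funM.
by exists (Mf * Mg) => x; rewrite normrM ler_pM.
Qed.

Lemma bounded_measurableD f g :
  bounded_measurable f -> bounded_measurable g ->
  bounded_measurable (fun x => f x + g x).
Proof.
move=> bf bg; have := bounded_measurable_lin 1 bf bg.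
by under eq_fun do rewrite mul1r.
Qed.

Lemma bounded_measurableZ c f :
  bounded_measurable f -> bounded_measurable (fun x => c * f x).
Proof. by apply: bounded_measurableM; exact: bounded_measurable_cst. Qed.

Lemma bounded_measurableN f :
  bounded_measurable f -> bounded_measurable (fun x => - f x).
Proof.
by move=> /(bounded_measurableZ (-1)); under eq_fun do rewrite mulN1r.
Qed.

Lemma bounded_measurable_sum (I : Type) (r : seq I) (F : I -> T -> R) :
  (forall i, bounded_measurable (F i)) ->
  bounded_measurable (fun x => \sum_(i <- r) F i x).
Proof.
move=> bF; elim: r => [|i r ih].
  by under eq_fun do rewrite big_nil; exact: bounded_measurable_cst.
by under eq_fun do rewrite big_cons; exact: bounded_measurableD.
Qed.

Lemma bounded_measurable_expR f :
  bounded_measurable f -> bounded_measurable (fun x => expR (f x)).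
Proof.
move=> [mf [M fM]]; split.
  by apply: (measurableT_comp (f := @expR R)) => //; exact: measurable_expR.
exists (expR M) => x; rewrite ger0_norm ?expR_ge0// ler_expR.
by rewrite (le_trans (ler_norm _)).
Qed.

(** One notion for integrals, pairings with charges, ultrafilter limits of pairings and centred sums
    along a path; [bounded_linear_ext] then identifies two of them by a test on indicators. *)
Definition bounded_linear L : Prop :=
  (forall c f g, bounded_measurable f -> bounded_measurable g ->
     L (fun x => c * f x + g x) = c * L f + L g) /\
  exists C, forall f M, bounded_measurable f -> (forall x, `|f x| <= M) ->
     `|L f| <= C * M.

Section bounded_linear_theory.
Variables (L : (T -> R) -> R) (bL : bounded_linear L).

Lemma bounded_linear_cst0 : L (fun=> 0) = 0.
Proof.
have b0 := bounded_measurable_cst 0.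
have := bL.1 1 _ _ b0 b0.
have -> : (fun x : T => 1 * 0 + 0 : R) = (fun=> 0).
  by apply/funext => x; rewrite mulr0 addr0.
lra.
Qed.

Lemma bounded_linearZ c f : bounded_measurable f ->
  L (fun x => c * f x) = c * L f.
Proof.
move=> bf; have := bL.1 c _ _ bf (bounded_measurable_cst 0).
by rewrite bounded_linear_cst0 addr0; under eq_fun do rewrite addr0.
Qed.

Lemma bounded_linearD f g : bounded_measurable f -> bounded_measurable g ->
  L (fun x => f x + g x) = L f + L g.
Proof.
move=> bf bg; have := bL.1 1 _ _ bf bg.
by rewrite mul1r; under eq_fun do rewrite mul1r.
Qed.

Lemma bounded_linearN f : bounded_measurable f -> L (fun x => - f x) = - L f.
Proof.
move=> /(bounded_linearZ (-1)); rewrite mulN1r => <-.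
by under eq_fun do rewrite -mulN1r.
Qed.

Lemma bounded_linear_sum (I : Type) (r : seq I) (F : I -> T -> R) :
  (forall i, bounded_measurable (F i)) ->
  L (fun x => \sum_(i <- r) F i x) = \sum_(i <- r) L (F i).
Proof.
move=> bF; elim: r => [|i r ih].
  by under eq_fun do rewrite big_nil; rewrite bounded_linear_cst0 big_nil.
under eq_fun do rewrite big_cons.
rewrite big_cons -ih bounded_linearD//; exact: bounded_measurable_sum.
Qed.

End bounded_linear_theory.

Lemma bounded_linearB L1 L2 : bounded_linear L1 -> bounded_linear L2 ->
  bounded_linear (fun f => L1 f - L2 f).
Proof.
move=> [l1 [C1 h1]] [l2 [C2 h2]]; split.
  by move=> c f g bf bg; rewrite l1// l2//; ring.
exists (C1 + C2) => f M bf fM.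
by rewrite (le_trans (ler_normB _ _))// mulrDl lerD// ?h1 ?h2.
Qed.

(** The sum counts the integers from 1 to [K] that are at most [y], so it is the integer part of
    [y]. *)
Lemma floor_layer_cake (K : nat) (y : R) : 0 <= y -> y <= K%:R ->
  y - 1 <= \sum_(0 <= k < K) (k.+1%:R <= y)%R%:R <= y.
Proof.
elim: K => [|K ih] y0 yK; first by rewrite big_geq//; lra.
rewrite big_nat_recr//=; have [yK'|yK'] := leP y K%:R.
  rewrite (_ : (K.+1%:R <= y)%R = false) ?addr0 ?ih//.
  by apply/negbTE; rewrite -ltNge (le_lt_trans yK')// ltr_nat.
rewrite (eq_big_nat _ _ (F2 := fun=> 1 : R)); last first.
  move=> k /andP[_ kK]; rewrite (_ : (k.+1%:R <= y)%R = true)//.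
  by rewrite (le_trans _ (ltW yK'))// ler_nat.
rewrite big_const_nat iter_addr addr0 subn0.
by move: yK; case: (leP K.+1%:R y) => /=; rewrite -natr1 => ? ?; lra.
Qed.

(** Rounding [f] down to multiples of [1 / N.+1] gives a finite combination of indicators at uniform
    distance at most [1 / N.+1], and the difference of the two functionals is continuous for the
    uniform norm. *)
Lemma bounded_linear_ext L1 L2 : bounded_linear L1 -> bounded_linear L2 ->
  (forall A, measurable A -> L1 \1_A = L2 \1_A) ->
  forall f, bounded_measurable f -> L1 f = L2 f.
Proof.
move=> b1 b2 L12 f bf; have bD := bounded_linearB b1 b2.
have [_ [C hC]] := bD.
have D1 A : measurable A -> L1 \1_A - L2 \1_A = 0 by move=> mA; rewrite L12 ?subrr.
apply/eqP; rewrite -subr_eq0 -normr_le0; apply/ler_addgt0Pr => e e0; rewrite add0r.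
have [mf [M fM]] := bf.
have [K fK] : exists K : nat, forall x, `|f x| <= K%:R.
  by exists (Num.trunc M).+1 => x; rewrite (le_trans (fM x))// ltW// truncnS_gt.
have [N CN] : exists N : nat, `|C| / N.+1%:R <= e.
  exists (Num.trunc (`|C| / e)); rewrite ler_pdivrMr// mulrC -ler_pdivrMr//.
  by rewrite ltW// truncnS_gt.
(* Adding [K], a bound of [f], makes [y] nonnegative and at most [N.+1 * (K + K)], the number of
   layers used in [h]. *)
pose y x := N.+1%:R * (f x + K%:R).
pose A k := [set x | k.+1%:R <= y x].
have by_ : bounded_measurable y.
  apply: bounded_measurableZ; apply: bounded_measurableD => //.
  exact: bounded_measurable_cst.
have mA k : measurable (A k).
  have := by_.1 measurableT `[k.+1%:R, +oo[%classic (measurable_itv _).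
  rewrite setTI; congr measurable; apply/seteqP.
  by split=> x /=; rewrite in_itv/= andbT.
pose h x := \sum_(0 <= k < N.+1 * (K + K)) (\1_(A k) x : R).
have bA k : bounded_measurable \1_(A k) by exact: bounded_measurable_indic.
have bh : bounded_measurable h by exact: bounded_measurable_sum.
have bT : bounded_measurable (\1_setT : T -> R) by exact: bounded_measurable_indic.
have bNh : bounded_measurable (fun x => N.+1%:R^-1 * h x).
  exact: bounded_measurableZ.
pose f' x := - K%:R * \1_setT x + N.+1%:R^-1 * h x.
have bf' : bounded_measurable f' by exact: bounded_measurable_lin.
pose D g := L1 g - L2 g; have bD' : bounded_linear D by [].
have Df' : D f' = 0.
  rewrite /f' bD'.1// (bounded_linearZ bD')// (bounded_linear_sum bD')//.
  by rewrite /D D1// big1 ?mulr0 ?addr0// => k _; rewrite D1.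
have -> : L1 f - L2 f = D (fun x => -1 * f' x + f x).
  by rewrite bD'.1// Df' mulr0 add0r.
apply: le_trans CN; apply: le_trans (_ : C * N.+1%:R^-1 <= _); last first.
  by rewrite ler_wpM2r ?ler_norm.
apply: hC; first exact: bounded_measurable_lin.
move=> x; rewrite mulN1r /f' indicT mulr1.
have := fK x; rewrite ler_norml => /andP[f1 f2].
have N0 : 0 < N.+1%:R :> R by [].
have y0 : 0 <= y x by rewrite mulr_ge0 // -lerBlDr sub0r.
have yK : y x <= (N.+1 * (K + K))%:R by rewrite natrM natrD ler_wpM2l // lerD2r.
have /andP[] := floor_layer_cake y0 yK.
have -> : \sum_(0 <= k < N.+1 * (K + K)) (k.+1%:R <= y x)%R%:R = h x.
  by apply: eq_bigr => k _; rewrite indicE; congr (nat_of_bool _)%:R;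
    apply/idP/idP => [?|/set_mem//]; rewrite inE.
have -> : f x = N.+1%:R^-1 * y x - K%:R by rewrite /y mulKf ?gt_eqF//; lra.
set t := N.+1%:R^-1; have t0 : 0 < t by rewrite invr_gt0.
move=> /(ler_wpM2l (ltW t0)); rewrite mulrBr mulr1 => h1.
move=> /(ler_wpM2l (ltW t0)) => h2; rewrite ler_norml.
have aux (r p q k : R) : p - r <= q -> q <= p -> - r <= - (- k + q) + (p - k) <= r.
  by move=> *; lra.
exact: aux.
Qed.

End bounded_measurable.

Section finite_measure_integral.
Context {d} {T : measurableType d} {R : realType}.
Variable mu : {finite_measure set T -> \bar R}.

Lemma bounded_measurable_integrable f : bounded_measurable f ->
  mu.-integrable setT (EFin \o f).
Proof.
move=> [mf [M fM]]; apply: measurable_bounded_integrable => //.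
  by rewrite ltey_eq fin_num_measure.
by exists M; split; [exact: num_real|move=> x Mx y _ /=; rewrite (le_trans (fM y)) ?ltW].
Qed.

Lemma Rintegral_indic A : measurable A -> \int[mu]_x (\1_A x) = fine (mu A).
Proof. by move=> mA; rewrite /Rintegral integral_indic// setIT. Qed.

Lemma Rintegral_bounded_linear : bounded_linear (fun f : T -> R => \int[mu]_x f x).
Proof.
split=> [c f g bf bg|].
  rewrite RintegralD ?RintegralZl//; try exact: bounded_measurable_integrable.
  by apply: (bounded_measurable_integrable (bounded_measurableZ c bf)).
exists (fine (mu setT)) => f M bf fM.
rewrite (le_trans (le_normr_Rintegral _ _))//.
  exact: bounded_measurable_integrable.
rewrite mulrC -Rintegral_cst//; apply: le_Rintegral => //.
- have [mf [N fN]] := bf.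
  apply: bounded_measurable_integrable; split; first exact: measurableT_comp.
  by exists N => x; rewrite normr_id.
- exact: (bounded_measurable_integrable (bounded_measurable_cst M)).
Qed.

Lemma Rintegral_le f g : bounded_measurable f -> bounded_measurable g ->
  (forall x, f x <= g x) -> \int[mu]_x f x <= \int[mu]_x g x.
Proof.
by move=> bf bg fg; apply: le_Rintegral => //; exact: bounded_measurable_integrable.
Qed.

End finite_measure_integral.

Section charges.
Context {R : realType}.
Implicit Types (nu : {charge set R -> \bar R}) (f : R -> R).

Lemma pairing_bounded_linear nu : bounded_linear (pairing^~ nu).
Proof. by apply: bounded_linearB; exact: Rintegral_bounded_linear. Qed.

Lemma pairing_indic nu A : measurable A -> pairing \1_A nu = fine (nu A).
Proof.
move=> mA; rewrite /pairing.
set h := projT2 _.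
rewrite !Rintegral_indic// (jordan_decomp h mA) /cadd/= cscaleN1.
by rewrite fineD ?fineN ?fin_numN ?fin_num_measure.
Qed.

End charges.

(** * Charges and compactness in the tau topology *)

Section charge_of_functional.
Context {d} {T : measurableType d} {R : realType}.
Variable L : (T -> R) -> R.
Hypothesis bL : bounded_linear L.
Hypothesis cL : forall B : nat -> set T, (forall n, measurable (B n)) ->
  (forall x, \forall n \near \oo, ~ B n x) ->
  L \1_(B n) @[n --> \oo] --> (0 : R).

Definition functional_charge (A : set T) : \bar R := (L \1_A)%:E.

Let functional_charge0 : functional_charge set0 = 0%E.
Proof.
rewrite /functional_charge (_ : \1_set0 = fun=> 0) ?bounded_linear_cst0//.
by apply/funext => x; rewrite indic0.
Qed.

Let functional_charge_fin A : measurable A -> functional_charge A \is a fin_num.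
Proof. by []. Qed.

(** [B n] is the union of the [F i] with [i >= n], and [L] of the indicator of the whole union is a
    partial sum plus [L] of the indicator of [B n]. By disjointness a point lies in at most one
    [F i], hence leaves the tails, and [cL] applies. *)
Let functional_charge_sigma : semi_sigma_additive functional_charge.
Proof.
move=> F mF tF mUF; rewrite /functional_charge.
pose B n := \bigcup_(i in [set i | (n <= i)%N]) F i.
have mB n : measurable (B n) by apply: bigcup_measurable => i _; exact: mF.
have -> : \bigcup_n F n = B 0%N by apply: eq_bigcupl; split=> i.
have LB n : L \1_(B 0%N) = \sum_(0 <= i < n) L \1_(F i) + L \1_(B n).
  elim: n => [|n ->]; first by rewrite big_geq// add0r.
  rewrite big_nat_recr//= -addrA; congr +%R.
  rewrite -bounded_linearD//; [|exact: bounded_measurable_indic..].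
  congr L; apply/funext => x; rewrite !indicE.
  have [Fx|nFx] := boolP (x \in F n).
    rewrite mem_set/=; last by exists n => //=; exact: set_mem.
    rewrite memNset ?addr0//= => -[i /= ni Fi].
    by have := tF i n I I (ex_intro _ x (conj Fi (set_mem Fx))) => E; move: ni; rewrite E ltnn.
  rewrite add0r; congr (nat_of_bool _)%:R; apply/idP/idP => /set_mem[i /= ni Fi].
    apply/mem_set; exists i => //=; rewrite ltn_neqAle ni andbT.
    by apply/eqP => E; move: nFx; rewrite E mem_set.
  by apply/mem_set; exists i => //=; exact: ltnW.
have LB0 : L \1_(B n) @[n --> \oo] --> (0 : R).
  apply: cL => // x.
  have [[i _ Fi]|nF] := pselect ((\bigcup_i F i) x); last first.
    by apply: nearW => n [i _ Fi]; apply: nF; exists i.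
  near=> n => -[j /= nj Fj].
  have E := tF i j I I (ex_intro _ x (conj Fi Fj)).
  have : (i < n)%N by near: n; exact: nbhs_infty_gt.
  by rewrite ltnNge E nj.
under eq_fun do rewrite sumEFin; apply: cvg_EFin; first exact: nearW.
rewrite -[X in _ --> X]subr0.
apply: (eq_cvg_to _ (cvgB (cvg_cst (L \1_(B 0%N))) LB0)) => n.
by rewrite !fctE (LB n) addrK.
Unshelve. all: by end_near. Qed.

HB.instance Definition _ := isCharge.Build _ _ _ functional_charge
  functional_charge0 functional_charge_fin functional_charge_sigma.

Lemma charge_of_functional :
  exists nu : {charge set T -> \bar R}, forall A, nu A = (L \1_A)%:E.
Proof. by exists functional_charge. Qed.

End charge_of_functional.

Section tau_topology.
Context {R : realType}.
Implicit Types (nu : tau_topology R) (f : R -> R).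

Lemma bounded_borelP f : bounded_measurable f <->
  (measurable_fun setT f /\ bounded_fun f).
Proof.
split=> -[mf].
  by move=> [M fM]; split=> //; exists M; split; [exact: num_real|
    move=> x Mx y _ /=; rewrite (le_trans (fM y)) ?ltW].
move=> [M [_ hM]]; split=> //; exists (M + 1) => x.
by apply: (hM (M + 1)) => //; rewrite ltrDl.
Qed.

Lemma tau_cvg (F : set_system (tau_topology R)) nu : Filter F ->
  (forall f, bounded_measurable f -> pairing f x @[x --> F] --> pairing f nu) ->
  F --> nu.
Proof.
move=> FF h; apply/cvg_sup => -[f bf] A /= [_ [[B Bop <-] Bfs sBfA]].
have hf := h f ((bounded_borelP f).2 bf).
have /hf FB : nbhs (pairing f nu) B by exact: open_nbhs_nbhs.
exact: filterS sBfA FB.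
Qed.

(** The image ultrafilter has a cluster point in the compact segment, and an ultrafilter converges
    to each of its cluster points. *)
Lemma ultra_bounded_cvg (T : Type) (U : set_system T) (u : T -> R) (a b : R) :
  UltraFilter U -> U [set x | a <= u x <= b] -> cvg (u x @[x --> U]).
Proof.
move=> UU Uab.
have [] := @segment_compact R a b (u @ U) _.
  by rewrite /= /fmap/=; apply: filterS Uab => x /=; rewrite in_itv.
move=> p [_ clp]; apply/cvg_ex; exists p => B Bp.
have [//|UnB] := in_ultra_setVsetC (u @^-1` B) UU.
by have [y []] := clp (~` B) B UnB Bp.
Qed.

(** For [v > 0] the best choice is [t = x / v]. For [v = 0] the linear function [t * x] is bounded
    by [l], which [t = (l + 1) / x] refutes unless [x = 0]. *)
Lemma quadratic_bound (x v l : R) : 0 <= v ->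
  (forall t, t * x <= 2^-1 * (t ^+ 2 * v) + l) -> x ^+ 2 <= 2 * l * v.
Proof.
move=> v0 h; have [v00|vn0] := eqVneq v 0.
  rewrite v00 mulr0; have [->|x0] := eqVneq x 0; first by rewrite expr0n.
  have := h ((l + 1) / x); rewrite v00 !mulr0 add0r mulfVK//; lra.
have {}v0 : 0 < v by rewrite lt_neqAle eq_sym vn0.
have := h (x / v).
have -> : x / v * x = x ^+ 2 / v by ring.
have -> : 2^-1 * ((x / v) ^+ 2 * v) = 2^-1 * (x ^+ 2 / v) by field.
move=> H; rewrite -ler_pdivrMr//; lra.
Qed.

End tau_topology.

Section compactness.
Context {R : realType} (w : nat -> R) (pw : probability_vector w).

Definition cumulant (f : R -> R) : R :=
  2^-1 * covar w (fun i => f i%:R) (fun i => f i%:R).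

Lemma bounded_measurable_nat (f : R -> R) : bounded_measurable f ->
  nbounded (fun i => f i%:R).
Proof. by move=> [_ [M fM]]; exists M. Qed.

Lemma cumulant_scale c f : bounded_measurable f ->
  cumulant (fun x => c * f x) = c ^+ 2 * cumulant f.
Proof.
move=> /bounded_measurable_nat bf; rewrite /cumulant variance_scale//; ring.
Qed.

Lemma cumulant_ge0 f : bounded_measurable f -> 0 <= cumulant f.
Proof.
move=> /bounded_measurable_nat bf; rewrite mulr_ge0 ?invr_ge0//.
exact: variance_ge0.
Qed.

Variable l : R.

(** Each constraint is asked to hold on its own set of [U], not all of them on a common one. This
    weaker form is what [closed_half_space_cover] can supply, where only finitely many constraints
    hold at once. *)
Lemma ultra_tau_cvg (U : set_system (tau_topology R)) : UltraFilter U ->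
  (forall f, bounded_measurable f -> U [set nu | pairing f nu <= cumulant f + l]) ->
  exists2 nu : tau_topology R,
    (forall f, bounded_measurable f -> pairing f nu <= cumulant f + l) &
    U --> nu.
Proof.
move=> UU Ul.
have Uc f : bounded_measurable f -> cvg (pairing f x @[x --> U]).
  (* The lower bound is the constraint for [- f], since [cumulant] is even. *)
  move=> bf; apply: (@ultra_bounded_cvg _ _ _ _ (- (cumulant f + l)) (cumulant f + l)).
  apply: (filterS _ (filterI (Ul _ bf) (Ul _ (bounded_measurableN bf)))) => nu [/= h1].
  rewrite (bounded_linearN (pairing_bounded_linear nu))//.
  have -> : cumulant (fun x => - f x) = cumulant f.
    have := cumulant_scale (-1) bf; rewrite sqrrN expr1n mul1r => <-.
    by congr cumulant; apply/funext => x; rewrite mulN1r.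
  by move=> h2; rewrite h1 andbT lerNl.
pose L (f : R -> R) : R := lim (pairing f x @[x --> U]).
have UL f : bounded_measurable f -> pairing f x @[x --> U] --> L f by exact: Uc.
have Ll f : bounded_measurable f -> L f <= cumulant f + l.
  by move=> bf; apply: (cvgr_to_le (UL f bf)); exact: Ul.
have Llin : forall c f g, bounded_measurable f -> bounded_measurable g ->
    L (fun x => c * f x + g x) = c * L f + L g.
  move=> c f g bf bg; rewrite {1}/L; apply: cvg_lim => //.
  apply: (eq_cvg_to _ (cvgD (cvgM (cvg_cst c) (UL _ bf)) (UL _ bg))) => nu.
  by rewrite !fctE/= (pairing_bounded_linear nu).1.
have b0 : bounded_measurable ((fun=> 0) : R -> R) by exact: bounded_measurable_cst.
have L0 : L (fun=> 0) = 0.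
  have := Llin 1 _ _ b0 b0.
  have -> : (fun x : R => 1 * 0 + 0 : R) = (fun=> 0).
    by apply/funext => x; rewrite mulr0 addr0.
  lra.
have LZ c f : bounded_measurable f -> L (fun x => c * f x) = c * L f.
  move=> bf; have := Llin c _ _ bf b0.
  by rewrite L0 addr0; under eq_fun do rewrite addr0.
have c0 : cumulant (fun=> 0) <= 0.
  have h0 : forall i : nat, `|0 : R| <= 0 by rewrite normr0.
  have := variance_le pw h0; by rewrite /cumulant expr0n/= pmulr_rle0 ?invr_gt0.
have l0 : 0 <= l by have := Ll _ b0; rewrite L0; lra.
(* The constraints for all multiples [t * f] give a quadratic inequality in [t]. *)
have Lq f : bounded_measurable f ->
    L f ^+ 2 <= 2 * l * covar w (fun i => f i%:R) (fun i => f i%:R).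
  move=> bf; apply: quadratic_bound; first exact/variance_ge0/bounded_measurable_nat.
  move=> t; have := Ll _ (bounded_measurableZ t bf).
  by rewrite LZ// cumulant_scale// /cumulant mulrCA.
have bL : bounded_linear L.
  split=> //; exists (Num.sqrt (2 * l)) => f M bf fM.
  have M0 : 0 <= M by apply: le_trans (fM 0).
  rewrite -(sqrtr_sqr (L f)) -[X in _ <= _ * X]ger0_norm// -sqrtr_sqr.
  rewrite -sqrtrM ?mulr_ge0// ler_wsqrtr// (le_trans (Lq _ bf))//.
  by rewrite ler_wpM2l ?mulr_ge0//; apply: variance_le => // i; exact: fM.
(* For an indicator, [Lq] bounds the square of [L] by [2 * l] times the mass that [w] gives to the
   set, and this mass tends to 0 by [mean_cvg0]. *)
have cL : forall B : nat -> set R, (forall n, measurable (B n)) ->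
    (forall x, \forall n \near \oo, ~ B n x) -> L \1_(B n) @[n --> \oo] --> (0 : R).
  move=> B mB Bx.
  have h0 : mean w (fun i => \1_(B n) i%:R) @[n --> \oo] --> (0 : R).
    apply: (mean_cvg0 (M := 1)) => // [n i|i].
      by rewrite indicE; case: (_ \in _); rewrite ?normr1 ?normr0.
    by apply: filterS (Bx i%:R) => n nB; rewrite indicE memNset.
  have h1 : 2 * l * mean w (fun i => \1_(B n) i%:R) @[n --> \oo] --> (0 : R).
    by rewrite -(mulr0 (2 * l)); apply: cvgM => //; exact: cvg_cst.
  have h2 : (L \1_(B n)) ^+ 2 @[n --> \oo] --> (0 : R).
    apply: squeeze_cvgr h1; last exact: cvg_cst.
    apply: nearW => n; rewrite sqr_ge0/= (le_trans (Lq _ (bounded_measurable_indic (mB n))))//.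
    rewrite ler_wpM2l ?mulr_ge0// /covar lerBlDr.
    have -> : (fun i => (\1_(B n) i%:R : R) * \1_(B n) i%:R) = (fun i => \1_(B n) i%:R).
      by apply/funext => i; rewrite indicE; case: (_ \in _); rewrite ?mulr1 ?mulr0.
    by rewrite lerDl -expr2 sqr_ge0.
  have h3 : `|L \1_(B n)| @[n --> \oo] --> (0 : R).
    rewrite -(sqrtr0 R).
    apply: (eq_cvg_to _ (cvg_comp _ _ h2 (@sqrt_continuous R 0))).
    by move=> n /=; rewrite sqrtr_sqr.
  exact: norm_cvg0 h3.
have [nu nuE] := charge_of_functional bL cL.
have nuL f : bounded_measurable f -> pairing f nu = L f.
  apply: (@bounded_linear_ext _ _ _ (pairing^~ nu) L) => //; first exact: pairing_bounded_linear.
  by move=> A mA; rewrite pairing_indic// nuE.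
exists nu; first by move=> f bf; rewrite nuL//; exact: Ll.
apply: tau_cvg => f bf.
by rewrite nuL//; exact: UL.
Qed.

End compactness.

(** * The moderate deviation principle from cumulant asymptotics *)

Section extended_real_limits.
Context {R : realType}.
Local Open Scope ereal_scope.
Implicit Types (u : nat -> \bar R).

Lemma limn_esup_near_le u c : (\forall n \near \oo, u n <= c) -> limn_esup u <= c.
Proof.
move=> uc; rewrite /limn_esup /limf_esup.
apply: (@le_trans _ _ (ereal_sup (u @` [set n | u n <= c]))).
  by apply: ereal_inf_lbound; exists [set n | u n <= c].
by apply: ge_ereal_sup => _ [n /= unc <-].
Qed.

Lemma limn_einf_near_ge u c : (\forall n \near \oo, c <= u n) -> c <= limn_einf u.
Proof.
move=> uc; rewrite /limn_einf leeNr; apply: limn_esup_near_le.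
by apply: filterS uc => n /=; rewrite leeN2.
Qed.

(** Reduces the upper bound to real levels, including the case where the infimum of the rate is
    infinite. *)
Lemma lee_forall_gt (x y : \bar R) :
  (forall c : R, x < c%:E -> y <= c%:E) -> y <= x.
Proof.
case: x => [x| |] h; last 2 first.
- exact: leey.
- rewrite leNgt; apply/negP; case: y h => [y| |] // h _.
    by have := h (y - 1)%R (ltNyr _); rewrite lee_fin; lra.
  by have := h 0%R (ltNyr _).
apply/lee_addgt0Pr => e e0; rewrite -EFinD; apply: h.
by rewrite lte_fin ltrDl.
Qed.

Lemma lne_le_fin (p x : R) : (p <= expR x)%R -> lne p%:E <= x%:E.
Proof.
move=> px; have [p0|p0] := leP p 0%R; first by rewrite le0_lneNy ?leNye.
by rewrite lne_EFin// lee_fin -(expRK x) ler_ln// posrE expR_gt0.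
Qed.

Lemma lne_ge_fin (p x : R) : (expR x <= p)%R -> x%:E <= lne p%:E.
Proof.
move=> px; have p0 : (0 < p)%R by rewrite (lt_le_trans (expR_gt0 x)).
by rewrite lne_EFin// lee_fin -(expRK x) ler_ln// posrE expR_gt0.
Qed.

End extended_real_limits.

Section exponential_growth.
Context {R : realType} (s : nat -> R).
Hypothesis soo : s n @[n --> \oo] --> +oo.

Lemma speed_gt0 : \forall n \near \oo, 0 < s n.
Proof. exact: (cvgryPgt _).1 soo 0. Qed.

Lemma expR_speed_ge (C e : R) : 0 < e -> \forall n \near \oo, C <= expR (s n * e).
Proof.
move=> e0; near=> n; apply: le_trans (expR_ge1Dx _).
apply: (@le_trans _ _ (s n * e)); last by rewrite lerDr.
rewrite -ler_pdivrMr//.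
by near: n; exact: (cvgryPge _).1 soo (C / e).
Unshelve. all: by end_near. Qed.

Lemma expR_speed_le (c e : R) : 0 < c -> 0 < e ->
  \forall n \near \oo, expR (- (s n * e)) <= c.
Proof.
move=> c0 e0; apply: filterS (expR_speed_ge c^-1 e0) => n h.
by rewrite expRN -[leRHS]invrK lef_pV2// posrE ?expR_gt0 ?invr_gt0.
Qed.

End exponential_growth.

Section tau_neighbourhoods.
Context {R : realType}.
Implicit Types (nu : tau_topology R) (g : nat -> bounded_borel R).

Lemma bounded_borel_measurable (f : bounded_borel R) : bounded_measurable (sval f).
Proof. exact/bounded_borelP/(svalP f). Qed.

Definition to_borel (f : R -> R) (bf : bounded_measurable f) : bounded_borel R :=
  exist _ f ((bounded_borelP f).1 bf).

Definition half_spaces nu N g : set (tau_topology R) :=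
  [set z | forall k, (k < N)%N -> pairing (sval (g k)) z < pairing (sval (g k)) nu + 1].

(** The half-spaces around [nu] form a filter base that converges to [nu] by [tau_cvg], so every
    neighbourhood contains a member of it; no description of the open sets of a supremum topology is
    needed. The margin 1 costs nothing, since the functions can be rescaled. *)
Lemma tau_nbhs_half_spaces nu (G : set (tau_topology R)) : open G -> G nu ->
  exists N g, half_spaces nu N g `<=` G.
Proof.
move=> oG Gnu.
pose D : set (nat * (nat -> bounded_borel R)) := setT.
pose B (p : nat * (nat -> bounded_borel R)) := half_spaces nu p.1 p.2.
have b0 : bounded_borel R := to_borel (bounded_measurable_cst 0).
have FB : Filter (filter_from D B).
  apply: filter_from_filter; first by exists (0%N, fun=> b0).
  move=> [N1 g1] [N2 g2] _ _.
  exists ((N1 + N2)%N, fun k => if (k < N1)%N then g1 k else g2 (k - N1)%N) => //.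
  move=> z /= h; split=> k kN.
    by have := h k (ltn_addr _ kN); rewrite /= in kN *; rewrite kN.
  have := h (N1 + k)%N; rewrite ltn_add2l => /(_ kN).
  by rewrite /= ltnNge leq_addr/= addKn.
have Bnu : filter_from D B --> nu.
  apply: tau_cvg => f bf; apply/cvgrPdist_lt => e e0.
  have e10 : 0 < e^-1 by rewrite invr_gt0.
  (* A two-sided window of radius [e] for [f] is the intersection of the unit half-spaces of [f / e]
     and [- f / e]. *)
  pose g (k : nat) := if k is 0 then to_borel (bounded_measurableZ e^-1 bf)
    else to_borel (bounded_measurableZ (- e^-1) bf).
  exists (2%N, g) => // z h.
  have /= := h 0%N isT; have /= := h 1%N isT.
  rewrite !(bounded_linearZ (pairing_bounded_linear _))// => h1 h2.
  have {}h1 : e^-1 * (pairing f nu - pairing f z) < 1 by rewrite mulrBr; lra.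
  have {}h2 : e^-1 * (pairing f z - pairing f nu) < 1 by rewrite mulrBr; lra.
  rewrite !ltr_pdivrMl// mulr1 in h1 h2.
  by rewrite ltr_norml h1 andbT ltrNl opprB.
have : filter_from D B G by apply: Bnu; exact: open_nbhs_nbhs.
by move=> [[N g] _ hG]; exists N, g.
Qed.

End tau_neighbourhoods.

(** * Half the variance and its Legendre transform *)

Section rate.
Context {R : realType} (w : nat -> R) (pw : probability_vector w).
Implicit Types (nu : tau_topology R).

(** The form that [rate_function] takes when every row of the matrix is [w]. *)
Definition legendre nu : \bar R :=
  ereal_sup [set (pairing (sval f) nu - cumulant w (sval f))%:E
            | f in [set: bounded_borel R]].

Lemma legendre_le nu (l : R) : (legendre nu <= l%:E)%E <->
  (forall f, bounded_measurable f -> pairing f nu <= cumulant w f + l).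
Proof.
split=> h.
  move=> f bf; have : ((pairing f nu - cumulant w f)%:E <= legendre nu)%E.
    by apply: ereal_sup_ubound; exists (to_borel bf).
  by move=> /le_trans/(_ h); rewrite lee_fin lerBlDl.
apply: ge_ereal_sup => _ [f _ <-]; rewrite lee_fin lerBlDl.
exact/h/bounded_borel_measurable.
Qed.

Lemma cumulant0 : cumulant w (fun=> 0) = 0.
Proof.
have b0 : bounded_measurable ((fun=> 0) : R -> R) by exact: bounded_measurable_cst.
apply/eqP; rewrite eq_le cumulant_ge0// andbT.
have h0 : forall i : nat, `|0 : R| <= 0 by rewrite normr0.
have := variance_le pw h0.
by rewrite /cumulant expr0n/= pmulr_rle0 ?invr_gt0.
Qed.

Lemma legendre_ge0 nu : (0 <= legendre nu)%E.
Proof.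
have b0 : bounded_measurable ((fun=> 0) : R -> R) by exact: bounded_measurable_cst.
apply: ereal_sup_ubound; exists (to_borel b0) => //=.
by rewrite cumulant0 (bounded_linear_cst0 (pairing_bounded_linear nu)) subr0.
Qed.

Lemma legendre_good : good_rate_function legendre.
Proof.
split; first exact: legendre_ge0.
move=> l l0; rewrite compact_ultra => U UU Ul.
have [nu nul Unu] : exists2 nu : tau_topology R,
    (forall f, bounded_measurable f -> pairing f nu <= cumulant w f + l) & U --> nu.
  apply: ultra_tau_cvg => // f bf; apply: filterS Ul => nu /=.
  by rewrite legendre_le; exact.
by exists nu; split => //; exact/legendre_le.
Qed.

(* Compactness in the form needed for the upper bound. *)
Lemma closed_half_space_cover (F : set (tau_topology R)) (l : R) : closed F ->
  (forall nu, F nu -> (l%:E < legendre nu)%E) ->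
  exists N (g : nat -> bounded_borel R), forall nu, F nu ->
    exists2 k, (k < N)%N & cumulant w (sval (g k)) + l < pairing (sval (g k)) nu.
Proof.
move=> cF Fl; apply: contrapT => nex.
pose D : set (nat * (nat -> bounded_borel R)) := setT.
(* Points of [F] that escape finitely many of the half-spaces. If no finite cover exists, all these
   sets are inhabited and generate a proper filter. *)
pose B (p : nat * (nat -> bounded_borel R)) := F `&`
  [set z | forall k, (k < p.1)%N ->
     pairing (sval (p.2 k)) z <= cumulant w (sval (p.2 k)) + l].
have b0 : bounded_borel R := to_borel (bounded_measurable_cst 0).
have FB : Filter (filter_from D B).
  apply: filter_from_filter; first by exists (0%N, fun=> b0).
  move=> [N1 g1] [N2 g2] _ _.
  exists ((N1 + N2)%N, fun k => if (k < N1)%N then g1 k else g2 (k - N1)%N) => //.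
  move=> z /= [Fz h]; split; split=> // k /= kN.
    by have := h k (ltn_addr _ kN); rewrite /= kN.
  have := h (N1 + k)%N; rewrite ltn_add2l => /(_ kN).
  by rewrite /= ltnNge leq_addr/= addKn.
have PB : ProperFilter (filter_from D B).
  apply: filter_from_proper => // -[N g] _; apply: contrapT => Bempty.
  apply: nex; exists N, g => nu Fnu; apply: contrapT => h.
  apply: Bempty; exists nu; split => // k kN; rewrite leNgt; apply/negP => hk.
  by apply: h; exists k.
have [U [UU BU]] := ultraFilterLemma PB.
have [nu nul Unu] : exists2 nu : tau_topology R,
    (forall f, bounded_measurable f -> pairing f nu <= cumulant w f + l) & U --> nu.
  apply: ultra_tau_cvg => // f bf; apply: BU.
  by exists (1%N, fun=> to_borel bf) => // z [_ /(_ 0%N isT)].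
have Fnu : F nu.
  apply: cF => V /Unu UV; have UF : U F.
    by apply: BU; exists (0%N, fun=> b0) => // z [].
  exact: filter_ex (filterI UF UV).
by have := Fl _ Fnu; rewrite ltNge => /negP; apply; exact/legendre_le.
Qed.

Lemma cumulant_lin t f g : bounded_measurable f -> bounded_measurable g ->
  cumulant w (fun x => t * f x + g x) = t ^+ 2 * cumulant w f +
    t * covar w (fun i => f i%:R) (fun i => g i%:R) + cumulant w g.
Proof.
move=> /bounded_measurable_nat bf /bounded_measurable_nat bg.
by rewrite /cumulant variance_lin//; field.
Qed.

(* The last equation comes from maximising along the ray through [g]. *)
Lemma legendre_near_max nu (r eta : R) : legendre nu = r%:E -> 0 < eta ->
  exists g, [/\ bounded_measurable g,
    r - eta < pairing g nu - cumulant w g &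
    pairing g nu = 2 * cumulant w g].
Proof.
move=> nur eta0.
have nul : (forall f, bounded_measurable f -> pairing f nu <= cumulant w f + r).
  by apply/legendre_le; rewrite nur.
have : ((r - eta)%:E < legendre nu)%E by rewrite nur lte_fin; lra.
move=> /ereal_sup_gt[_ [[g bg] _ <-]].
rewrite /= lte_fin => hg; have {}bg := (bounded_borelP g).2 bg.
have lin := pairing_bounded_linear nu.
(* When [g] has variance zero, [quadratic_bound] makes its pairing with [nu] vanish too, so [g]
   itself satisfies the equation. *)
have [v0|v0] := eqVneq (cumulant w g) 0.
  exists g; split => //; rewrite v0 mulr0.
  have : pairing g nu ^+ 2 <= 2 * r * 0.
    apply: quadratic_bound => // t.
    have := nul _ (bounded_measurableZ t bg).
    by rewrite (bounded_linearZ lin)// cumulant_scale// v0 !mulr0.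
  rewrite mulr0 => h; apply/eqP; rewrite -sqrf_eq0 eq_le h sqr_ge0//.
have {}v0 : 0 < cumulant w g by rewrite lt_neqAle eq_sym v0 cumulant_ge0.
(* The maximiser of [t * p - t ^ 2 * v], where the value is [p ^ 2 / (4 * v)]. *)
pose t := pairing g nu / (2 * cumulant w g).
exists (fun x => t * g x); split; first exact: bounded_measurableZ.
  rewrite (bounded_linearZ lin)// cumulant_scale//; apply: lt_le_trans hg _.
  set p := pairing g nu in t *; set v := cumulant w g in v0 t *.
  have -> : t * p - t ^+ 2 * v = p ^+ 2 / (4 * v) by rewrite /t; field; rewrite gt_eqF.
  rewrite ler_pdivlMr; last by rewrite mulr_gt0.
  rewrite -subr_ge0.
  have -> : p ^+ 2 - (p - v) * (4 * v) = (p - 2 * v) ^+ 2 by ring.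
  exact: sqr_ge0.
rewrite (bounded_linearZ lin)// cumulant_scale//.
set p := pairing g nu in t *; set v := cumulant w g in v0 t *.
by rewrite /t; field; rewrite gt_eqF.
Qed.

(** First-order optimality up to [eta]: compare [g] with [g - f / K] for [K = M ^ 2 + 1]. After
    multiplication by [K], the defect of [g] costs less than [K * eta] and the second-order term
    costs [cumulant w f / K]; each is kept to one half. *)
Lemma near_max_covar nu (r eta M : R) (f g : R -> R) : legendre nu = r%:E ->
  bounded_measurable f -> bounded_measurable g ->
  r - eta < pairing g nu - cumulant w g -> (forall x, `|f x| <= M) ->
  eta * (M ^+ 2 + 1) <= 2^-1 ->
  covar w (fun i => f i%:R) (fun i => g i%:R) < pairing f nu + 1.
Proof.
move=> nur bf bg hg fM etaM.
have nul : (forall f, bounded_measurable f -> pairing f nu <= cumulant w f + r).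
  by apply/legendre_le; rewrite nur.
pose K := M ^+ 2 + 1; have K0 : 0 < K by rewrite ltr_wpDl// sqr_ge0.
have := nul _ (bounded_measurable_lin (- K^-1) bf bg).
rewrite (pairing_bounded_linear nu).1// cumulant_lin//.
set c := covar _ _ _; set p := pairing f nu.
have vM : 2 * cumulant w f <= M ^+ 2.
  by rewrite /cumulant mulVKf// variance_le// => i; exact: fM.
move=> h.
have : K * (- K^-1 * p + pairing g nu) <=
       K * ((- K^-1) ^+ 2 * cumulant w f + - K^-1 * c + cumulant w g + r).
  by rewrite ler_pM2l.
have -> : K * (- K^-1 * p + pairing g nu) = - p + K * pairing g nu by field; rewrite gt_eqF.
have -> : K * ((- K^-1) ^+ 2 * cumulant w f + - K^-1 * c + cumulant w g + r)
  = K^-1 * cumulant w f - c + K * (cumulant w g + r) by field; rewrite gt_eqF.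
have h2 : K^-1 * cumulant w f <= 2^-1.
  by rewrite ler_pdivrMl//; rewrite /K; lra.
have h3 : K * (r - eta) < K * (pairing g nu - cumulant w g) by rewrite ltr_pM2l.
have h4 : K * eta <= 2^-1 by rewrite mulrC.
lra.
Qed.

End rate.

(** * Upper and lower tails of random charges with prescribed cumulants *)

Section moderate_deviations_from_cumulants.
Context {R : realType} {d} {Omega : measurableType d} (Pr : probability Omega R).
Variables (w : nat -> R) (pw : probability_vector w).
Variables (Z : nat -> Omega -> tau_topology R) (s : nat -> R).
Hypothesis mZ : forall n A, measurable [set x | A (Z n x)].
Hypothesis bZ : forall n (f : R -> R), bounded_measurable f ->
  bounded_measurable (fun x => pairing f (Z n x)).
Hypothesis soo : s n @[n --> \oo] --> +oo.
(** Convergence of the normalised logarithmic moment generating functions to [cumulant], stated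
    without logarithms. *)
Hypothesis cumZ : forall (f : R -> R) (e : R), bounded_measurable f -> 0 < e ->
  \forall n \near \oo,
    expR (s n * (cumulant w f - e)) <=
      \int[Pr]_x expR (s n * pairing f (Z n x)) <=
    expR (s n * (cumulant w f + e)).

Let E := fun f : Omega -> R => \int[Pr]_x f x.
Let bE : bounded_linear E := Rintegral_bounded_linear Pr.
Let ez n (f : R -> R) := fun x => expR (s n * pairing f (Z n x)).

Let bez n f : bounded_measurable f -> bounded_measurable (ez n f).
Proof. by move=> bf; apply/bounded_measurable_expR/bounded_measurableZ/bZ. Qed.

Let bind n A : bounded_measurable (\1_[set x | A (Z n x)] : Omega -> R).
Proof. exact: bounded_measurable_indic. Qed.

Let probE n A : Pr [set x | A (Z n x)] = (E \1_[set x | A (Z n x)])%:E.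
Proof. by rewrite /E Rintegral_indic// fineK// fin_num_measure. Qed.

(** Exponential Chebyshev on each half-space of the cover, then a union bound. One half of [e] pays
    for the error in the cumulants, the other for the factor [N]. *)
Lemma upper_tail (F : set (tau_topology R)) (l e : R) : closed F -> 0 < e ->
  (forall nu, F nu -> (l%:E < legendre w nu)%E) ->
  \forall n \near \oo, E \1_[set x | F (Z n x)] <= expR (- (s n * (l - e))).
Proof.
move=> cF e0 Fl; have [N [g hg]] := closed_half_space_cover pw cF Fl.
have bg k := bounded_borel_measurable (g k).
have e20 : 0 < e / 2 by rewrite divr_gt0.
have cum : \forall n \near \oo, forall k, (k < N)%N ->
    E (ez n (sval (g k))) <= expR (s n * (cumulant w (sval (g k)) + e / 2)).
  elim: (N) => [|K ih]; first exact: nearW.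
  have := cumZ (bg K) e20; move=> /(filterI ih); apply: filterS.
  move=> n [hK /andP[_ hK1]] k.
  by rewrite ltnS leq_eqVlt => /predU1P[->//|]; exact: hK.
near=> n.
have s0 : 0 < s n by near: n; exact: speed_gt0.
pose C k := expR (- (s n * (cumulant w (sval (g k)) + l))).
have bh k : bounded_measurable (fun x => C k * ez n (sval (g k)) x).
  exact/bounded_measurableZ/bez.
(* On the event, some half-space contains [Z n x], and its summand has a nonnegative exponent, hence
   is at least 1. *)
have h1 : E \1_[set x | F (Z n x)] <=
    E (fun x => \sum_(0 <= k < N) C k * ez n (sval (g k)) x).
  apply: Rintegral_le => //; first exact: bounded_measurable_sum.
  move=> x; rewrite indicE; have [|_] := boolP (x \in _); last first.
    by apply: sumr_ge0 => k _; rewrite mulr_ge0 ?expR_ge0.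
  move=> /set_mem/= /hg[k kN hk].
  rewrite big_mkord (bigD1 (Ordinal kN))//= ler_wpDr//.
    by apply: sumr_ge0 => j _; rewrite mulr_ge0 ?expR_ge0.
  rewrite /C /ez -expRD -[leLHS]expR0 ler_expR.
  by rewrite -mulrN -mulrDr mulr_ge0 ?(ltW s0)// addrC subr_ge0 ltW.
apply: (le_trans h1); rewrite (bounded_linear_sum bE)//.
apply: (@le_trans _ _ (\sum_(0 <= k < N) expR (- (s n * (l - e / 2))))).
  rewrite !big_mkord; apply: ler_sum => k _.
  rewrite (bounded_linearZ bE)//; last exact: bez.
  have hc : E (ez n (sval (g k))) <= expR (s n * (cumulant w (sval (g k)) + e / 2)).
    by move: (k : nat) (ltn_ord k); near: n.
  apply: (le_trans (ler_wpM2l (expR_ge0 _) hc)).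
  rewrite /C -expRD le_eqVlt; apply/orP; left; apply/eqP; congr expR.
  by field.
rewrite big_const_nat subn0 iter_addr addr0 -[leLHS]mulr_natl.
have -> : - (s n * (l - e)) = s n * (e / 2) - s n * (l - e / 2) by field.
rewrite expRD ler_wpM2r ?expR_ge0//.
by near: n; exact: expR_speed_ge.
Unshelve. all: by end_near. Qed.

(* Under the measure tilted by [g], the pairing with [f] concentrates at
   [covar f g], so an event pushing it above [x > covar f g] is negligible. *)
Lemma tilted_tail (f g : R -> R) (x c : R) : bounded_measurable f -> bounded_measurable g ->
  covar w (fun i => f i%:R) (fun i => g i%:R) < x -> 0 < c ->
  \forall n \near \oo,
    E (fun y => \1_[set y | x <= pairing f (Z n y)] y * ez n g y) <= c * E (ez n g).
Proof.
move=> bf bg; set cv := covar _ _ _ => cvx c0.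
pose dl := x - cv; have dl0 : 0 < dl by rewrite subr_gt0.
pose v := cumulant w f; have v0 : 0 <= v by exact: cumulant_ge0.
(* This [t] makes [t ^ 2 * v] at most half of [t * dl], with the [+ 1] covering [v = 0]. The other
   half of [t * dl] is [4 * e]: two cumulant errors [e] and a margin [2 * e] that beats the constant
   [c]. *)
pose t := dl / (2 * v + 1).
have v10 : 0 < 2 * v + 1 by rewrite ltr_wpDl// mulr_ge0.
have t0 : 0 < t by rewrite divr_gt0.
have tv : t * (2 * v) <= dl.
  by rewrite /t mulrAC ler_pdivrMr// ler_wpM2l ?(ltW dl0)// lerDl.
pose e := t * dl / 8; have e0 : 0 < e by rewrite divr_gt0// mulr_gt0.
have btg := bounded_measurable_lin t bf bg.
near=> n.
have s0 : 0 < s n by near: n; exact: speed_gt0.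
have up : E (ez n (fun x => t * f x + g x)) <=
    expR (s n * (cumulant w (fun x => t * f x + g x) + e)).
  by near: n; have := cumZ btg e0; apply: filterS => m /andP[].
have lo : expR (s n * (cumulant w g - e)) <= E (ez n g).
  by near: n; have := cumZ bg e0; apply: filterS => m /andP[].
apply: (@le_trans _ _ (expR (- (s n * (t * x))) * E (ez n (fun x => t * f x + g x)))).
  rewrite -(bounded_linearZ bE); last exact: bez.
  apply: Rintegral_le.
  - apply: bounded_measurableM (bez _ bg).
    exact: (bind n [set z | x <= pairing f z]).
  - exact/bounded_measurableZ/bez.
  move=> y; rewrite indicE; have [|_] := boolP (y \in _); last first.
    by rewrite mul0r mulr_ge0 ?expR_ge0.
  move=> /set_mem/= xy; rewrite mul1r /ez -expRD ler_expR.
  rewrite (pairing_bounded_linear (Z n y)).1//.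
  move: (pairing f _) (pairing g _) xy => p q xp.
  rewrite -subr_ge0 (_ : _ - _ = s n * (t * (p - x))); last by ring.
  by rewrite mulr_ge0 ?(ltW s0)// mulr_ge0 ?(ltW t0)// subr_ge0.
apply: (le_trans (ler_wpM2l (expR_ge0 _) up)).
apply: le_trans (ler_wpM2l (ltW c0) lo).
have hc : expR (- (s n * (2 * e))) <= c.
  by near: n; apply: expR_speed_le => //; rewrite mulr_gt0.
apply: (@le_trans _ _ (expR (- (s n * (2 * e))) * expR (s n * (cumulant w g - e)))); last first.
  by rewrite ler_wpM2r ?expR_ge0.
rewrite -!expRD ler_expR (cumulant_lin _ _ bf bg) -/v -/cv.
move: (cumulant w g) => vg; have -> : x = dl + cv by rewrite /dl; ring.
rewrite -subr_ge0 (_ : _ - _ = s n * (t * (2^-1 * (dl - t * (2 * v))))).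
  apply: mulr_ge0; [exact: ltW|apply: mulr_ge0; first exact: ltW].
  by rewrite mulr_ge0// subr_ge0.
by rewrite /e; field.
Unshelve. all: by end_near. Qed.

(** Tilt by a near maximiser [g]. The [N] half-spaces defining a neighbourhood inside [G], together
    with a cap on the pairing with [g], fail on at most half of the tilted mass. On the remaining
    half the tilting density is at most [K], so [K] times the probability of [G] is at least half of
    [E (ez n g)]. *)
Lemma lower_tail (G : set (tau_topology R)) (nu : tau_topology R) (r e : R) : open G -> G nu ->
  legendre w nu = r%:E -> 0 < e ->
  \forall n \near \oo, expR (- (s n * (r + e))) <= E \1_[set x | G (Z n x)].
Proof.
move=> oG Gnu nur e0; have [N [h hG]] := tau_nbhs_half_spaces oG Gnu.
have bh k := bounded_borel_measurable (h k).
have [M hM] : exists M : R, forall k, (k < N)%N -> forall x, `|sval (h k) x| <= M.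
  elim: (N) => [|K [M hM]]; first by exists 0.
  have [_ [M' hM']] := bh K; exists (Num.max M M') => k.
  rewrite ltnS leq_eqVlt => /predU1P[-> x|kK x]; rewrite le_max.
    by rewrite hM' orbT.
  by rewrite hM.
have M1 : 0 < M ^+ 2 + 1 by rewrite ltr_wpDl// sqr_ge0.
pose eta := 2^-1 / (M ^+ 2 + 1).
have eta0 : 0 < eta by rewrite divr_gt0.
have [g [bg hg gg]] := legendre_near_max pw nur eta0.
have gr : cumulant w g <= r.
  have := (legendre_le w nu r).1 _ g bg; rewrite nur => /(_ (lexx _)); lra.
have hcv k : (k < N)%N -> covar w (fun i => sval (h k) i%:R) (fun i => g i%:R) <
    pairing (sval (h k)) nu + 1.
  move=> kN; apply: (near_max_covar pw nur (bh k) bg hg (hM k kN)).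
  by rewrite /eta mulfVK// gt_eqF.
(* The variance of [g] equals its pairing with [nu], so a cap slightly above that pairing is
   exceeded only on a negligible part of the tilted mass. *)
have gcv : covar w (fun i => g i%:R) (fun i => g i%:R) < pairing g nu + e / 2.
  rewrite gg /cumulant mulVKf// ltrDl divr_gt0//.
(* There are [N.+1] bad events, each allowed the fraction [c] of the tilted mass: one half in
   all. *)
pose c : R := (2 * N.+1%:R)^-1.
have c0 : 0 < c by rewrite invr_gt0 mulr_gt0.
pose bad n f x y : R := \1_[set y | x <= pairing f (Z n y)] y * ez n g y.
have bbad n f x : bounded_measurable (bad n f x).
  apply: bounded_measurableM (bez _ bg).
  exact: (bind n [set z | x <= pairing f z]).
have tails : \forall n \near \oo, forall k, (k < N)%N ->
    E (bad n (sval (h k)) (pairing (sval (h k)) nu + 1)) <= c * E (ez n g).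
  elim: (N) hcv => [|K ih hcv]; first by move=> _; exact: nearW.
  have := tilted_tail (bh K) bg (hcv K (ltnSn K)) c0.
  have := ih (fun k kK => hcv k (ltnW kK)).
  move=> ih' hK; apply: filterS (filterI ih' hK) => n [h1 h2] k.
  by rewrite ltnS leq_eqVlt => /predU1P[->//|]; exact: h1.
have e40 : 0 < e / 4 by rewrite divr_gt0.
near=> n.
have s0 : 0 < s n by near: n; exact: speed_gt0.
have lo : expR (s n * (cumulant w g - e / 4)) <= E (ez n g).
  by near: n; have := cumZ bg e40; apply: filterS => m /andP[].
have tg : E (bad n g (pairing g nu + e / 2)) <= c * E (ez n g).
  by near: n; exact: tilted_tail.
have tk k : (k < N)%N ->
    E (bad n (sval (h k)) (pairing (sval (h k)) nu + 1)) <= c * E (ez n g).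
  by move: k; near: n.
pose K := expR (s n * (pairing g nu + e / 2)).
pose S y := \sum_(0 <= k < N) bad n (sval (h k)) (pairing (sval (h k)) nu + 1) y.
have bS : bounded_measurable S by exact: bounded_measurable_sum.
have bT : bounded_measurable (fun y => bad n g (pairing g nu + e / 2) y + S y).
  exact: bounded_measurableD.
have bad0 f x y : 0 <= bad n f x y by rewrite mulr_ge0 ?expR_ge0// indicE.
have split1 : E (ez n g) <= E (fun y => K * \1_[set x | G (Z n x)] y +
     (bad n g (pairing g nu + e / 2) y + S y)).
  apply: Rintegral_le; [exact: bez|exact: bounded_measurable_lin|].
  move=> y; have S0 : 0 <= S y by apply: sumr_ge0.
  have T0 := bad0 g (pairing g nu + e / 2) y.
  have K0 : 0 <= K * \1_[set x | G (Z n x)] y.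
    by rewrite mulr_ge0 ?expR_ge0// indicE.
  have [hgy|hgy] := leP (pairing g nu + e / 2) (pairing g (Z n y)).
    have -> : bad n g (pairing g nu + e / 2) y = ez n g y.
      by rewrite /bad indicE mem_set// mul1r.
    lra.
  have [[k kN hk]|nk] := pselect (exists2 k, (k < N)%N &
      pairing (sval (h k)) nu + 1 <= pairing (sval (h k)) (Z n y)).
    suff : ez n g y <= S y by lra.
    rewrite /S big_mkord (bigD1 (Ordinal kN))//= ler_wpDr//; first exact: sumr_ge0.
    by rewrite /bad indicE mem_set// mul1r.
  have Gy : G (Z n y).
    by apply: hG => k kN; rewrite ltNge; apply/negP => hk; apply: nk; exists k.
  suff : ez n g y <= K * \1_[set x | G (Z n x)] y by lra.
  by rewrite indicE mem_set// mulr1 ler_expR ler_wpM2l// ltW.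
have split2 : E (ez n g) <= K * E \1_[set x | G (Z n x)] + N.+1%:R * (c * E (ez n g)).
  apply: (le_trans split1); rewrite bE.1//= lerD2l.
  rewrite (bounded_linearD bE)// (bounded_linear_sum bE)// -[N.+1%:R]natr1 mulrDl mul1r addrC.
  apply: lerD => //; rewrite mulr_natl -[X in _ *+ X]card_ord -sumr_const.
  by rewrite big_mkord; apply: ler_sum => k _; exact: tk.
have cE : N.+1%:R * (c * E (ez n g)) = 2^-1 * E (ez n g).
  by rewrite mulrA /c invfM mulrCA mulfV ?mulr1 ?pnatr_eq0.
have key : 2^-1 * expR (s n * (cumulant w g - e / 4)) <= K * E \1_[set x | G (Z n x)].
  have : 2^-1 * expR (s n * (cumulant w g - e / 4)) <= 2^-1 * E (ez n g).
    by rewrite ler_wpM2l.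
  rewrite cE in split2; lra.
have half : expR (- (s n * (e / 4))) <= 2^-1.
  by near: n; apply: expR_speed_le.
rewrite -(ler_pM2l (expR_gt0 (s n * (pairing g nu + e / 2)))) -/K.
apply: le_trans key.
apply: (@le_trans _ _ (expR (- (s n * (e / 4))) * expR (s n * (cumulant w g - e / 4)))); last first.
  by rewrite ler_wpM2r ?expR_ge0.
(* With the pairing of [g] equal to [2 * cumulant w g], the exponents differ by [r - cumulant w g],
   nonnegative by [gr]; the slack [e] is used as [e / 2] for the cap, [e / 4] for the cumulant and
   [e / 4] for the factor one half. *)
rewrite /K -!expRD ler_expR gg -!mulrN -!mulrDr ler_wpM2l ?(ltW s0)//.
lra.
Unshelve. all: by end_near. Qed.

Theorem mdp_of_cumulants :
  satisfies_mdp (fun n A => Pr [set x | A (Z n x)]) s (legendre w).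
Proof.
split; first exact: legendre_good.
  move=> G oG; rewrite leeNl; apply: le_ereal_inf_tmp => _ [nu Gnu <-].
  rewrite leeNl.
  case E1 : (legendre w nu) => [r| |]; last 2 first.
  - by rewrite leNye.
  - by have := legendre_ge0 pw nu; rewrite E1.
  apply/lee_subgt0Pr => e e0; apply: limn_einf_near_ge.
  near=> n; rewrite probE.
  have s0 : 0 < s n by near: n; exact: speed_gt0.
  rewrite -EFinN -EFinB lee_pdivlMl// -EFinM lne_ge_fin//.
  have -> : s n * (- r - e) = - (s n * (r + e)) by ring.
  by near: n; exact: (lower_tail oG Gnu E1 e0).
move=> F cF; apply: lee_forall_gt => c hc.
apply/lee_addgt0Pr => e e0; rewrite -EFinD; apply: limn_esup_near_le.
have Fl nu : F nu -> ((- c)%:E < legendre w nu)%E.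
  move=> Fnu; apply: (@lt_le_trans _ _ (ereal_inf [set legendre w nu | nu in F])).
    by rewrite EFinN lteNl.
  by apply: ereal_inf_lbound; exists nu.
near=> n; rewrite probE.
have s0 : 0 < s n by near: n; exact: speed_gt0.
rewrite lee_pdivrMl// -EFinM lne_le_fin//.
have -> : s n * (c + e) = - (s n * (- c - e)) by ring.
by near: n; exact: (upper_tail cF e0 Fl).
Unshelve. all: by end_near. Qed.

End moderate_deviations_from_cumulants.

(** * Exponential moments of the chain *)

Section exponential_bounds.
Context {R : realType}.

(** Since [(m.+3)!] is at least [2 ^ m.+1], the terms from the cubic one on are dominated by
    [|y| ^ 3] times a geometric series of sum 1. *)
Lemma expR_taylor2 (y : R) : `|y| <= 1 ->
  `|expR y - (1 + y + y ^+ 2 / 2)| <= `|y| ^+ 3.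
Proof.
move=> y1.
have fact_ge m : (2 ^ m.+1 <= (m.+3)`!)%N.
  elim: m => [//|m ih]; rewrite expnS factS leq_mul//.
have part m : `|\sum_(0 <= k < m.+3) y ^+ k / k`!%:R - (1 + y + y ^+ 2 / 2)|
    <= `|y| ^+ 3 * (1 - 2 ^- m).
  elim: m => [|m ih].
    rewrite !big_nat_recr//= big_geq// expr0 expr1 invr1 subrr mulr0.
    rewrite normr_le0 subr_eq0; apply/eqP.
    by rewrite ?factS ?fact0 ?muln1 ?divr1 add0r !mulr1.
  rewrite big_nat_recr//= addrAC (le_trans (ler_normD _ _))//.
  have -> : `|y| ^+ 3 * (1 - 2 ^- m.+1) =
      `|y| ^+ 3 * (1 - 2 ^- m) + `|y| ^+ 3 * 2 ^- m.+1.
    by rewrite -mulrDr; congr (_ * _); rewrite exprS invfM; field; rewrite expf_neq0.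
  rewrite lerD//; rewrite normrM normrX normfV normr_nat.
  rewrite ler_pM ?exprn_ge0 ?invr_ge0//.
    by rewrite -[m.+3]addn3 exprD ler_piMl ?exprn_ge0 ?exprn_ile1.
  by rewrite lef_pV2 ?posrE ?exprn_gt0 ?ltr0n ?fact_gt0// -natrX ler_nat.
have cv : `|series (exp_coeff y) n - (1 + y + y ^+ 2 / 2)| @[n --> \oo] -->
    `|expR y - (1 + y + y ^+ 2 / 2)|.
  by apply: cvg_norm; apply: cvgB; [exact: is_cvg_series_exp_coeff|exact: cvg_cst].
apply: (cvgr_to_le cv); near=> n.
have n3 : (3 <= n)%N by near: n; exact: nbhs_infty_ge.
rewrite -(subnK n3) addn3; apply: le_trans (part _) _.
by rewrite ler_piMr ?exprn_ge0// lerBlDr lerDl invr_ge0 exprn_ge0.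
Unshelve. all: by end_near. Qed.

(** The logarithm of [1 + x] is at least [x / (1 + x)], which is at least [x - 2 * x ^ 2] on this
    range. *)
Lemma expR_le1Dx (x : R) : `|x| <= 2^-1 -> expR (x - 2 * x ^+ 2) <= 1 + x.
Proof.
rewrite ler_norml => /andP[x1 x2].
have x0 : 0 < 1 + x by lra.
have : expR (x / (1 + x)) <= 1 + x.
  rewrite -[leRHS]invrK -[leLHS]invrK lef_pV2 ?posrE ?invr_gt0 ?expR_gt0//.
  rewrite -expRN; apply: le_trans (expR_ge1Dx _).
  by rewrite le_eqVlt; apply/orP; left; apply/eqP; field; rewrite gt_eqF.
apply: le_trans; rewrite ler_expR -subr_ge0.
have -> : x / (1 + x) - (x - 2 * x ^+ 2) = x ^+ 2 * (1 + 2 * x) / (1 + x).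
  by field; rewrite gt_eqF.
by rewrite divr_ge0 ?(ltW x0)// mulr_ge0 ?sqr_ge0//; lra.
Qed.

End exponential_bounds.

(** * Integrals summed over the fibres of a countably valued map *)

Section countable_decomposition.
Context {R : realType} {d} {Omega : measurableType d} (Pr : probability Omega R).
Let E := fun f : Omega -> R => \int[Pr]_x f x.
Let bE : bounded_linear E := Rintegral_bounded_linear Pr.

Variable N : Omega -> nat.
Hypothesis mN : forall m, measurable (N @^-1` [set m]).
Let ind m : Omega -> R := \1_(N @^-1` [set m]).

Let bind m : bounded_measurable (ind m).
Proof. exact: bounded_measurable_indic. Qed.

Lemma measurable_fibers (B : set nat) : measurable (N @^-1` B).
Proof.
have -> : N @^-1` B = \bigcup_(m in B) (N @^-1` [set m]).
  by apply/seteqP; split=> [x Bx|x [m Bm /= xm]]; [exists (N x)|rewrite xm].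
by apply: bigcup_measurable => m _; exact: mN.
Qed.

(** The error after [n] fibres is the integral of [f] over [N >= n], at most [|C|] times the
    probability of that event, which vanishes by sigma-additivity. *)
Lemma sum_fiber_cvg (f : Omega -> R) : bounded_measurable f ->
  \sum_(0 <= m < n) E (fun x => ind m x * f x) @[n --> \oo] --> E f.
Proof.
move=> bf; have [_ [C fC]] := bf.
have bfm m : bounded_measurable (fun x => ind m x * f x).
  exact: bounded_measurableM.
have p1 : \sum_(0 <= m < n) E (ind m) @[n --> \oo] --> (1 : R).
  suff : (\sum_(0 <= m < n) E (ind m))%:E @[n --> \oo] --> (1%:E : \bar R).
    by move=> /fine_cvgP[].
  have <- : Pr (\bigcup_m (N @^-1` [set m])) = 1%:E.
    rewrite -(@probability_setT _ _ _ Pr); congr (Pr _).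
    by apply/seteqP; split => // x _; exists (N x).
  have tN : trivIset setT (fun m => N @^-1` [set m]).
    by move=> i j _ _ [x [/= <- <-]].
  have := @measure_semi_sigma_additive _ _ _ Pr _ mN tN
    (bigcupT_measurable _ mN).
  apply: cvg_trans; apply: near_eq_cvg; apply: nearW => n.
  rewrite -sumEFin; apply: eq_bigr => m _.
  by rewrite /E Rintegral_indic// fineK// fin_num_measure.
(* [S n] is the indicator of [N x < n], written as a sum over fibres. *)
pose S n x := \sum_(0 <= m < n) ind m x.
have S1 n x : 0 <= 1 - S n x.
  rewrite subr_ge0 /S big_mkord; have [xn|xn] := ltnP (N x) n.
    rewrite (bigD1 (Ordinal xn))//= big1 => [|i /negP ni].
      by rewrite addr0 /ind indicE; case: (_ \in _).
    rewrite /ind indicE memNset//= => Nx; apply: ni; apply/eqP/val_inj.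
    by rewrite /= Nx.
  rewrite big1// => i _; rewrite /ind indicE memNset//= => Nx.
  by have := ltn_ord i; rewrite -Nx ltnNge xn.
have bS n : bounded_measurable (fun x => -1 * S n x + 1).
  apply: bounded_measurable_lin; first exact: bounded_measurable_sum.
  exact: bounded_measurable_cst.
have E1 : E (fun=> 1) = 1.
  rewrite /E Rintegral_cst ?mul1r; last by [].
  exact: (congr1 fine (@probability_setT _ _ _ Pr)).
have ES n : E (fun x => -1 * S n x + 1) = 1 - \sum_(0 <= m < n) E (ind m).
  rewrite bE.1 ?(bounded_linear_sum bE) ?E1//; last exact: bounded_measurable_cst.
    by rewrite mulN1r addrC.
  exact: bounded_measurable_sum.
have C1 : forall x, `|f x| <= `|C| by move=> x; rewrite (le_trans (fC x)) ?ler_norm.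
have bound n : `|E f - \sum_(0 <= m < n) E (fun x => ind m x * f x)| <=
    `|C| * (1 - \sum_(0 <= m < n) E (ind m)).
  rewrite -(bounded_linear_sum bE)//.
  have -> : E f - E (fun x => \sum_(0 <= m < n) ind m x * f x) =
      E (fun x => -1 * (\sum_(0 <= m < n) ind m x * f x) + f x).
    by rewrite bE.1// ?mulN1r 1?addrC//; exact: bounded_measurable_sum.
  rewrite -ES -(bounded_linearZ bE)//.
  have bL : bounded_measurable (fun x => -1 * (\sum_(0 <= m < n) ind m x * f x) + f x).
    by apply: bounded_measurable_lin => //; exact: bounded_measurable_sum.
  have bRS := bounded_measurableZ `|C| (bS n).
  have pt x : `|-1 * (\sum_(0 <= m < n) ind m x * f x) + f x| <=
      `|C| * (-1 * S n x + 1).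
    rewrite -mulr_suml -/(S n x).
    have -> : -1 * (S n x * f x) + f x = (1 - S n x) * f x by ring.
    rewrite normrM (ger0_norm (S1 n x)) mulrC.
    have -> : -1 * S n x + 1 = 1 - S n x by ring.
    by rewrite ler_wpM2r.
  rewrite ler_norml -(bounded_linearN bE)//; apply/andP; split.
    apply: Rintegral_le => //; first exact: bounded_measurableN.
    by move=> x; have := pt x; rewrite ler_norml => /andP[].
  by apply: Rintegral_le => // x; apply: le_trans (pt x); exact: ler_norm.
apply/cvgrPdist_le => e e0.
have e1 : 0 < e / (`|C| + 1) by rewrite divr_gt0// ltr_wpDl.
have /cvgrPdist_le/(_ _ e1) := p1; apply: filterS => n hn.
apply: (le_trans (bound n)); apply: le_trans (ler_wpM2l (normr_ge0 C) _) _.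
  exact: le_trans (ler_norm _) hn.
rewrite mulrA ler_pdivrMr; last by rewrite ltr_wpDl.
by rewrite mulrC ler_pM2l// lerDl.
Qed.

Lemma Rintegral_le_fibers (f g : Omega -> R) :
  bounded_measurable f -> bounded_measurable g ->
  (forall m, E (fun x => ind m x * f x) <= E (fun x => ind m x * g x)) ->
  E f <= E g.
Proof.
move=> bf bg fg; apply: (ler_cvg_to (sum_fiber_cvg bf) (sum_fiber_cvg bg)).
by apply: nearW => n; apply: ler_sum => m _.
Qed.

End countable_decomposition.

(** * The Markov property in integrated form *)

Section markov_chain.
Context {R : realType} {d} {Omega : measurableType d} (Pr : probability Omega R).
Variables (X : nat -> {RV Pr >-> nat}) (mu0 : nat -> R) (Pn : nat -> nat -> nat -> R).
Hypothesis hX : is_markov_chain X mu0 Pn.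
Let E := fun f : Omega -> R => \int[Pr]_x f x.
Let bE : bounded_linear E := Rintegral_bounded_linear Pr.

(** Packs the whole history up to time [n] into one natural number, so that its fibres are the atoms
    of the past and the countable decomposition applies. *)
Fixpoint path_code (n : nat) (w : Omega) : nat :=
  if n is m.+1 then pickle (path_code m w, X m.+1 w) else X 0%N w.

Lemma path_codeP n w w' : path_code n w = path_code n w' <->
  forall k, (k <= n)%N -> X k w = X k w'.
Proof.
elim: n => [|n ih] /=.
  by split=> [h k|]; [rewrite leqn0 => /eqP ->|exact].
split=> [/(pcan_inj (@pickleK _))[/ih h hn] k|h].
  by rewrite leq_eqVlt => /predU1P[->//|]; exact: h.
congr (pickle (_, _)); last exact: h.
by apply/ih => k kn; apply: h; exact: leqW.
Qed.

Lemma measurable_state n (B : set nat) : measurable (X n @^-1` B).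
Proof. by rewrite -[X in measurable X]setTI; exact: (measurable_funP (X n)). Qed.

Lemma measurable_path_code n (B : set nat) : measurable (path_code n @^-1` B).
Proof.
suff : forall m, measurable (path_code n @^-1` [set m]) by move=> h; exact: measurable_fibers.
elim: n => [|n ih] m /=; first exact: (measurable_state 0 [set m]).
(* The fibre is empty unless [m] decodes to a pair that encodes back to [m]. *)
case E1 : (unpickle m : option (nat * nat)%type) => [[a b]|]; last first.
  rewrite [X in measurable X](_ : _ = set0)//; apply/seteqP; split => // w /= h.
  by move: E1; rewrite -h pickleK.
have [mab|mab] := eqVneq (pickle (a, b)) m; last first.
  rewrite [X in measurable X](_ : _ = set0)//; apply/seteqP; split => // w /= h.
  by move: E1; rewrite -h pickleK => -[ha hb]; move: mab; rewrite -h ha hb eqxx.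
rewrite [X in measurable X](_ : _ = path_code n @^-1` [set a] `&` X n.+1 @^-1` [set b]).
  by apply: measurableI; [exact: ih|exact: measurable_state].
apply/seteqP; split => w /=.
  by rewrite -mab => /(pcan_inj (@pickleK _))[].
by move=> [-> ->].
Qed.

Lemma bounded_measurable_state n (H : nat -> R) (M : R) : (forall j, `|H j| <= M) ->
  bounded_measurable (fun w => H (X n w)).
Proof.
move=> HM; split; first by apply: (measurableT_comp (f := H)).
by exists M => w.
Qed.

Lemma transition_probability_vector n i : (0 < n)%N -> states i ->
  probability_vector (Pn n i).
Proof.
move=> n0 si; have [_ _ /(_ n n0)[P0 P1] _ _] := hX.
by split; [move=> j sj; exact: P0|exact: P1].
Qed.

Let past n w0 := path_code n @^-1` [set path_code n w0].

Lemma mean_on_past n w0 (H : nat -> R) (M : R) : (forall j, `|H j| <= M) ->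
  E (fun w => \1_(past n w0) w * H (X n.+1 w)) =
  E \1_(past n w0) * mean (Pn n.+1 (X n w0)) H.
Proof.
move=> HM; have [sX _ _ hM hpast] := hX.
have mA : measurable (past n w0) by exact: measurable_path_code.
have bA : bounded_measurable (\1_(past n w0) : Omega -> R).
  exact: bounded_measurable_indic.
have bH := bounded_measurable_state n.+1 HM.
have M0 : 0 <= M by apply: le_trans (HM 0%N).
(* A null history is treated apart, because [is_markov_chain] constrains nothing there; both sides
   are then 0. *)
have [pA|pA] := eqVneq (E \1_(past n w0)) 0.
  have A0 w : 0 <= \1_(past n w0) w :> R by rewrite indicE.
  rewrite pA mul0r; apply/eqP; rewrite -normr_le0.
  have -> : 0 = M * E \1_(past n w0) by rewrite pA mulr0.
  rewrite -(bounded_linearZ bE)// ler_norml -(bounded_linearN bE); last first.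
    exact: bounded_measurableZ.
  have pt w : `|\1_(past n w0) w * H (X n.+1 w)| <= M * \1_(past n w0) w.
    by rewrite normrM ger0_norm// mulrC ler_wpM2r.
  have bl := bounded_measurableM bA bH.
  have br := bounded_measurableZ M bA.
  apply/andP; split.
    apply: Rintegral_le => //; first exact: bounded_measurableN.
    by move=> w; have := pt w; rewrite ler_norml => /andP[].
  by apply: Rintegral_le => // w; apply: le_trans (pt w); exact: ler_norm.
have PA : Pr (past n w0) = (E \1_(past n w0))%:E.
  by rewrite /E Rintegral_indic// fineK// fin_num_measure.
have PA0 : (0 < Pr (past n w0))%E.
  rewrite lt_neqAle measure_ge0 andbT PA eq_sym.
  by apply: contra pA => /eqP[->].
have Xn0 : (0 < Pr [set w | X n w = X n w0])%E.
  apply: (lt_le_trans PA0); apply: le_measure; rewrite ?inE//.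
    exact: (measurable_state n [set X n w0]).
  by move=> w /= /path_codeP; exact.
have joint j : E (fun w => \1_(past n w0) w * \1_(X n.+1 @^-1` [set j]) w) =
    if j \in states then E \1_(past n w0) * Pn n.+1 (X n w0) j else 0.
  have mj : measurable (X n.+1 @^-1` [set j]) by exact: measurable_state.
  have -> : (fun w => \1_(past n w0) w * \1_(X n.+1 @^-1` [set j]) w : R) =
      \1_(past n w0 `&` X n.+1 @^-1` [set j]).
    by apply/funext => w; rewrite indicI.
  have [sj|sj] := boolP (j \in states); last first.
    have -> : past n w0 `&` X n.+1 @^-1` [set j] = set0.
      apply/seteqP; split => // w [_ /= Xj]; move/negP : sj; apply.
      by rewrite inE -Xj.
    by rewrite /E Rintegral_indic// measure0.
  rewrite /E !Rintegral_indic//; last exact: measurableI.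
  have {}sj := set_mem sj.
  (* A path that follows [w0] up to time [n] and is then constantly [j], hence stays in [states] as
     the Markov property requires. *)
  pose x k := if (k <= n)%N then X k w0 else j.
  have sx k : states (x k) by rewrite /x; case: ifP.
  have pastE : [set w | forall k, (k <= n)%N -> X k w = x k] = past n w0.
    apply/seteqP; split => w /=.
      by move=> h; apply/path_codeP => k kn; rewrite h// /x kn.
    by move=> /path_codeP h k kn; rewrite h// /x kn.
  have := hpast n x sx; rewrite pastE => /(_ PA0).
  rewrite /x ltnn leqnn (hM n (X n w0) j)// /cond_prob setIC => <-.
  by rewrite mulrC divfK// PA.
have bf := bounded_measurableM bA bH.
have mX j : measurable (X n.+1 @^-1` [set j]) by exact: measurable_state.
have c1 := sum_fiber_cvg (Pr := Pr) mX bf.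
have c2 : E \1_(past n w0) *
    (\sum_(0 <= j < J | j \in states) Pn n.+1 (X n w0) j * H j) @[J --> \oo] -->
    (E \1_(past n w0) * mean (Pn n.+1 (X n w0)) H : R).
  apply: cvgM; first exact: cvg_cst.
  exact: (mean_cvg (transition_probability_vector (ltn0Sn n) (sX n w0)) HM).
pose u (J : nat) : R := \sum_(0 <= j < J) E (fun w => \1_(X n.+1 @^-1` [set j]) w *
  (\1_(past n w0) w * H (X n.+1 w))).
have c3 : u @ \oo --> (E \1_(past n w0) * mean (Pn n.+1 (X n w0)) H : R).
  apply: (eq_cvg_to _ c2) => J; rewrite mulr_sumr big_mkcond/=.
  apply: eq_bigr => j _.
  transitivity (H j * E (fun w => \1_(past n w0) w * \1_(X n.+1 @^-1` [set j]) w)).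
    by rewrite joint; case: ifP => _; ring.
  rewrite -(bounded_linearZ bE); last first.
    by apply: bounded_measurableM => //; exact: bounded_measurable_indic.
  congr E; apply/funext => w.
  have -> : \1_(X n.+1 @^-1` [set j]) w = (X n.+1 w == j)%:R :> R.
    rewrite indicE; congr (nat_of_bool _)%:R.
    by apply/idP/eqP => [/set_mem//|?]; rewrite inE.
  by have [->|_] := eqVneq (X n.+1 w) j; rewrite /= ?mulr1 ?mulr0 ?mul0r ?mul1r ?mulr0// mulrC.
exact: (cvg_unique _ c1 c3).
Qed.

(** [Y] depends only on the history, so on a fibre of [path_code] it is a constant that comes out of
    the integral, and the next step is averaged by a row. Lower bounds follow by applying this to
    [- H]. *)
Lemma markov_step n (Y : Omega -> R) (H : nat -> R) (M c : R) :
  bounded_measurable Y -> (forall w, 0 <= Y w) ->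
  (forall w w', (forall k, (k <= n)%N -> X k w = X k w') -> Y w = Y w') ->
  (forall j, `|H j| <= M) ->
  (forall i, states i -> mean (Pn n.+1 i) H <= c) ->
  E (fun w => Y w * H (X n.+1 w)) <= c * E Y.
Proof.
move=> bY Y0 Ypast HM Hc; have [sX _ _ _ _] := hX.
have bH := bounded_measurable_state n.+1 HM.
have mN m : measurable (path_code n @^-1` [set m]) by exact: measurable_path_code.
rewrite -(bounded_linearZ bE)//.
apply: (Rintegral_le_fibers mN); [exact: bounded_measurableM|exact: bounded_measurableZ|].
move=> m; have [[w0 hw0]|nw0] := pselect (exists w0, path_code n w0 = m); last first.
  have -> : path_code n @^-1` [set m] = set0.
    by apply/seteqP; split => // w /= hw; apply: nw0; exists w.
  rewrite le_eqVlt; apply/orP; left; apply/eqP; apply: eq_Rintegral => w _.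
  by rewrite !indic0 !mul0r.
rewrite -hw0 -/(past n w0).
have bA : bounded_measurable (\1_(past n w0) : Omega -> R).
  by apply: bounded_measurable_indic; exact: measurable_path_code.
have YE w : \1_(past n w0) w * Y w = \1_(past n w0) w * Y w0.
  rewrite indicE; have [|_] := boolP (w \in _); last by rewrite !mul0r.
  by move=> /set_mem/path_codeP h; rewrite (Ypast _ _ h).
have -> : (fun w => \1_(past n w0) w * (Y w * H (X n.+1 w))) =
    (fun w => Y w0 * (\1_(past n w0) w * H (X n.+1 w))).
  by apply/funext => w; rewrite mulrA YE mulrAC mulrC.
have -> : (fun w => \1_(past n w0) w * (c * Y w)) =
    (fun w => Y w0 * c * \1_(past n w0) w).
  by apply/funext => w; rewrite mulrCA YE; ring.
rewrite [X in X <= _](bounded_linearZ bE); last exact: bounded_measurableM.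
rewrite [X in _ <= X](bounded_linearZ bE)// -mulrA ler_wpM2l// [E _](mean_on_past _ _ HM).
rewrite mulrC ler_wpM2r ?Hc//.
by apply: Rintegral_ge0 => w _; rewrite indicE.
Qed.

End markov_chain.

(** * One-step estimates for the exponential moments *)

Section moment_generating_function.
Context {R : realType} {d} {Omega : measurableType d} (Pr : probability Omega R).
Variables (X : nat -> {RV Pr >-> nat}) (mu0 : nat -> R) (Pn : nat -> nat -> nat -> R).
Hypothesis hX : is_markov_chain X mu0 Pn.
Variables (w : nat -> R) (pw : probability_vector w) (dl et : nat -> R).
Hypothesis hdl : forall k i i' (H : nat -> R) (M : R), (0 < k)%N ->
  states i -> states i' -> (forall j, `|H j| <= M) ->
  `|mean (Pn k i) H - mean (Pn k i') H| <= M * dl k.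
Hypothesis het : forall k i (H : nat -> R) (M : R), (0 < k)%N ->
  states i -> (forall j, `|H j| <= M) ->
  `|mean (Pn k i) H - mean w H| <= M * et k.
Let E := fun f : Omega -> R => \int[Pr]_x f x.
Let bE : bounded_linear E := Rintegral_bounded_linear Pr.

Lemma expectation_cst (c : R) : E (fun=> c) = c.
Proof.
rewrite /E Rintegral_cst; last by [].
by rewrite [fine _](congr1 fine (@probability_setT _ _ _ Pr)) mulr1.
Qed.

Lemma expectation_state_le n (H : nat -> R) (M c : R) :
  (forall j, `|H j| <= M) -> (forall i, states i -> mean (Pn n.+1 i) H <= c) ->
  E (fun x => H (X n.+1 x)) <= c.
Proof.
move=> HM Hc.
have := markov_step hX (bounded_measurable_cst 1) (fun=> ler01) (fun _ _ _ => erefl) HM Hc.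
rewrite -/(E (fun=> 1)) expectation_cst mulr1.
by under eq_Rintegral do rewrite mul1r.
Qed.

Lemma expectation_state_ge n (H : nat -> R) (M c : R) :
  (forall j, `|H j| <= M) -> (forall i, states i -> c <= mean (Pn n.+1 i) H) ->
  c <= E (fun x => H (X n.+1 x)).
Proof.
move=> HM Hc; rewrite -lerN2 -(bounded_linearN bE); last first.
  exact: (bounded_measurable_state X n.+1 HM).
have NM : forall j, `|- H j| <= M by move=> j; rewrite normrN.
apply: (@expectation_state_le n (fun j => - H j) M (- c) NM) => i si.
have pv := transition_probability_vector hX (ltn0Sn n) si.
have := mean_lin pv (-1) HM (fun=> lexx `|0 : R|).
under eq_fun do rewrite mulN1r addr0.
by rewrite mean_cst// addr0 mulN1r => ->; rewrite lerN2 Hc.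
Qed.

Section bounded_observable.
Variables (f : nat -> R) (M : R).
Hypothesis fM : forall j, `|f j| <= M.

Definition state_mean k : R := E (fun x => f (X k x)).

Let M0 : 0 <= M. Proof. exact: le_trans (fM 0%N). Qed.

Lemma state_mean_norm k : `|state_mean k| <= M.
Proof.
have bf := bounded_measurable_state X k fM.
have fk x : - M <= f (X k x) <= M by rewrite -ler_norml.
rewrite ler_norml -[X in _ <= _ <= X]expectation_cst -[X in X <= _ <= _]expectation_cst.
by apply/andP; split; apply: Rintegral_le => //;
  try exact: bounded_measurable_cst; move=> x; have /andP[] := fk x.
Qed.

(** The expectation of [f (X n.+1)] is an average of the row means, any two of which differ by at
    most [M * dl n.+1]. *)
Lemma mean_state_mean n i : states i ->
  `|mean (Pn n.+1 i) f - state_mean n.+1| <= M * dl n.+1.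
Proof.
move=> si; have h i' : states i' ->
    `|mean (Pn n.+1 i') f - mean (Pn n.+1 i) f| <= M * dl n.+1.
  by move=> si'; apply: hdl.
rewrite ler_norml lerBrDr lerBlDr; apply/andP; split.
  rewrite addrC -lerBrDr opprK; apply: (expectation_state_le fM) => i' /h.
  by rewrite ler_norml => /andP[_]; rewrite lerBlDl.
rewrite -lerBlDl; apply: (expectation_state_ge fM) => i' /h.
by rewrite ler_norml => /andP[+ _]; rewrite lerBrDl.
Qed.

Lemma state_mean_stationary n : `|state_mean n.+1 - mean w f| <= M * et n.+1.
Proof.
have h i : states i -> `|mean (Pn n.+1 i) f - mean w f| <= M * et n.+1.
  by move=> si; apply: het.
rewrite ler_norml lerBrDr lerBlDr; apply/andP; split.
  apply: (expectation_state_ge fM) => i /h.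
  by rewrite ler_norml => /andP[+ _]; rewrite lerBrDr.
apply: (expectation_state_le fM) => i /h.
by rewrite ler_norml => /andP[_]; rewrite lerBlDr.
Qed.

Let V := covar w f f.
Variable b : R.
Hypothesis b0 : 0 < b.
Hypothesis bM : 2 * M * b <= 1.

(** The three terms bound the conditional drift of the centred variable, half of [b ^ 2] times the
    error [6 * M ^ 2 * et k] in the second moment, and the Taylor remainder [(2 * M * b) ^ 3]. *)
Definition step_error k : R :=
  M * b * dl k + 3 * M ^+ 2 * b ^+ 2 * et k + 8 * M ^+ 3 * b ^+ 3.

Let fm n j : `|f j - state_mean n| <= 2 * M.
Proof.
rewrite (le_trans (ler_normB _ _))// mulr2n mulrDl mul1r lerD// ?fM//.
exact: state_mean_norm.
Qed.

Let y n j := b * (f j - state_mean n).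

Let yM n j : `|y n j| <= 2 * M * b.
Proof. by rewrite normrM gtr0_norm// mulrC ler_wpM2r ?fm ?ltW. Qed.

(** Of the constant 6, 4 comes from replacing the row by [w] for a function bounded by [4 * M ^ 2],
    and 2 from centring at [state_mean] instead of the mean under [w]. *)
Let second_moment n i : states i ->
  `|mean (Pn n.+1 i) (fun j => (f j - state_mean n.+1) ^+ 2) - V| <=
  6 * M ^+ 2 * et n.+1.
Proof.
move=> si; set m := state_mean n.+1.
have QM j : `|(f j - m) ^+ 2| <= 4 * M ^+ 2.
  rewrite normrX; have -> : 4 * M ^+ 2 = (2 * M) ^+ 2 by ring.
  by rewrite lerXn2r ?nnegrE ?mulr_ge0// fm.
have h1 := het (ltn0Sn n) si QM.
have bf : nbounded f by exists M.
have bcst (c : R) : nbounded (fun=> c) by exists `|c|.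
have h2 : mean w (fun j => (f j - m) ^+ 2) = V + (m - mean w f) ^+ 2.
  have -> : (fun j => (f j - m) ^+ 2) =
      (fun j => (- (2 * m)) * f j + (1 * (f j * f j) + m ^+ 2)).
    by apply/funext => j; ring.
  rewrite meanP//; last by apply: nbounded_lin => //; exact: nboundedM.
  rewrite meanP//; last exact: nboundedM.
  by rewrite mean_cst// /V /covar; ring.
have h3 : `|(m - mean w f) ^+ 2| <= 2 * M ^+ 2 * et n.+1.
  have -> : 2 * M ^+ 2 * et n.+1 = (2 * M) * (M * et n.+1) by ring.
  rewrite normrX expr2 ler_pM ?state_mean_stationary//.
  rewrite (le_trans (ler_normB _ _))// mulr2n mulrDl mul1r lerD//.
    exact: state_mean_norm.
  exact: mean_norm.
rewrite (_ : _ - V = (mean (Pn n.+1 i) (fun j => (f j - m) ^+ 2) -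
  mean w (fun j => (f j - m) ^+ 2)) + (m - mean w f) ^+ 2); last by rewrite h2; ring.
rewrite (le_trans (ler_normD _ _))//; apply: le_trans (lerD h1 h3) _.
by rewrite le_eqVlt; apply/orP; left; apply/eqP; ring.
Qed.

Let expy n j : `|expR (y n j)| <= expR 1.
Proof.
by rewrite ger0_norm ?expR_ge0// ler_expR (le_trans (ler_norm _))// (le_trans (yM _ _)).
Qed.

Lemma step_bound n i : states i ->
  `|mean (Pn n.+1 i) (fun j => expR (y n.+1 j)) - (1 + 2^-1 * b ^+ 2 * V)| <=
  step_error n.+1.
Proof.
move=> si; have pv := transition_probability_vector hX (ltn0Sn n) si.
set m := state_mean n.+1; set q := mean (Pn n.+1 i).
have bf : nbounded f by exists M.
have bcst (c : R) : nbounded (fun=> c) by exists `|c|.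
have bQ : nbounded (fun j => (f j - m) ^+ 2).
  exists ((2 * M) ^+ 2) => j; rewrite normrX.
  by rewrite lerXn2r ?nnegrE ?mulr_ge0// fm.
have bexp : nbounded (fun j => expR (y n.+1 j)) by exists (expR 1); exact: expy.
(* The quadratic Taylor polynomial of the exponential at [y n.+1 j], regrouped for [meanP]. *)
pose T j := 2^-1 * b ^+ 2 * (f j - m) ^+ 2 + (b * f j + (1 - b * m)).
have bT : nbounded T by apply: nbounded_lin => //; exact: nbounded_lin.
have qT : q T = 2^-1 * b ^+ 2 * q (fun j => (f j - m) ^+ 2) + (b * q f + (1 - b * m)).
  by rewrite /q /T meanP ?meanP ?mean_cst//; exact: nbounded_lin.
have h1 : `|q (fun j => expR (y n.+1 j)) - q T| <= 8 * M ^+ 3 * b ^+ 3.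
  have -> : q (fun j => expR (y n.+1 j)) - q T = q (fun j => -1 * T j + expR (y n.+1 j)).
    by rewrite /q (meanP pv (-1) bT bexp) mulN1r addrC.
  apply: mean_norm => // j; rewrite mulN1r addrC.
  have -> : T j = 1 + y n.+1 j + y n.+1 j ^+ 2 / 2 by rewrite /T /y -/m; field.
  apply: le_trans (expR_taylor2 (le_trans (yM _ _) bM)) _.
  have -> : 8 * M ^+ 3 * b ^+ 3 = (2 * M * b) ^+ 3 by ring.
  by rewrite lerXn2r ?nnegrE ?mulr_ge0// ltW.
have h2 := mean_state_mean n si; rewrite -/m -/q in h2.
have h3 := second_moment n si; rewrite -/m -/q in h3.
have -> : q (fun j => expR (y n.+1 j)) - (1 + 2^-1 * b ^+ 2 * V) =
  b * (q f - m) + 2^-1 * b ^+ 2 * (q (fun j => (f j - m) ^+ 2) - V) +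
  (q (fun j => expR (y n.+1 j)) - q T).
  by rewrite qT; move: (q f) (q _) (q _) => e1 e2 e3; ring.
rewrite (le_trans (ler_normD _ _))// /step_error lerD//.
rewrite (le_trans (ler_normD _ _))// lerD//.
  by rewrite normrM (gtr0_norm b0) mulrC mulrAC ler_wpM2r// ltW.
have c0 : 0 <= 2^-1 * b ^+ 2 by rewrite mulr_ge0// sqr_ge0.
rewrite normrM (ger0_norm c0); apply: le_trans (ler_wpM2l c0 h3) _.
by rewrite le_eqVlt; apply/orP; left; apply/eqP; field.
Qed.

Definition exp_sum n (x : Omega) : R :=
  expR (b * \sum_(1 <= k < n.+1) (f (X k x) - state_mean k)).

Lemma exp_sum_bounded n : bounded_measurable (exp_sum n).
Proof.
apply/bounded_measurable_expR/bounded_measurableZ/bounded_measurable_sum => k.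
apply: (bounded_measurable_state X k (H := fun j => f j - state_mean k) (M := 2 * M)).
exact: fm.
Qed.

Lemma exp_sum_past n x x' : (forall k, (k <= n)%N -> X k x = X k x') ->
  exp_sum n x = exp_sum n x'.
Proof.
move=> h; rewrite /exp_sum; congr (expR (_ * _)); apply: eq_big_nat => k.
by rewrite ltnS => /andP[_ kn]; rewrite h.
Qed.

Lemma exp_sumS n x : exp_sum n.+1 x = exp_sum n x * expR (y n.+1 (X n.+1 x)).
Proof. by rewrite /exp_sum big_nat_recr//= mulrDr expRD. Qed.

Lemma exp_sum0 : E (exp_sum 0) = 1.
Proof.
rewrite -[RHS]expectation_cst; apply: eq_Rintegral => x _.
by rewrite /exp_sum big_geq// mulr0 expR0.
Qed.

Lemma exp_sum_step n :
  (1 + 2^-1 * b ^+ 2 * V - step_error n.+1) * E (exp_sum n) <= E (exp_sum n.+1) <=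
  (1 + 2^-1 * b ^+ 2 * V + step_error n.+1) * E (exp_sum n).
Proof.
have ES : E (exp_sum n.+1) = E (fun x => exp_sum n x * expR (y n.+1 (X n.+1 x))).
  by apply: eq_Rintegral => x _; exact: exp_sumS.
have ge0 x : 0 <= exp_sum n x by exact: expR_ge0.
have NM : forall j, `|- expR (y n.+1 j)| <= expR 1.
  by move=> j; rewrite normrN; exact: expy.
apply/andP; split; rewrite ES.
  have := markov_step (n := n) (c := - (1 + 2^-1 * b ^+ 2 * V - step_error n.+1))
    hX (exp_sum_bounded n) ge0 (@exp_sum_past n) NM.
  have -> : (fun x => exp_sum n x * (fun j => - expR (y n.+1 j)) (X n.+1 x)) =
      (fun x => - (exp_sum n x * expR (y n.+1 (X n.+1 x)))).
    by apply/funext => x; rewrite mulrN.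
  rewrite -/(E _) -/(E _) (bounded_linearN bE) ?mulNr ?lerN2; last first.
    apply: bounded_measurableM; first exact: exp_sum_bounded.
    exact: (bounded_measurable_state X n.+1 (expy n.+1)).
  apply=> i si; have pv := transition_probability_vector hX (ltn0Sn n) si.
  have := mean_lin pv (-1) (expy n.+1) (fun=> lexx `|0 : R|).
  under eq_fun do rewrite mulN1r addr0.
  rewrite mean_cst// addr0 mulN1r => ->; rewrite lerN2.
  by have := step_bound n si; rewrite ler_norml => /andP[+ _]; rewrite lerBrDr addrC.
apply: (markov_step hX (exp_sum_bounded n) ge0 (@exp_sum_past n) (expy n.+1)).
by move=> i si; have := step_bound n si; rewrite ler_norml => /andP[_]; rewrite lerBlDl.
Qed.

Lemma exp_sum_upper n :
  E (exp_sum n) <= expR (\sum_(1 <= k < n.+1) (2^-1 * b ^+ 2 * V + step_error k)).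
Proof.
elim: n => [|n ih]; first by rewrite exp_sum0 big_geq// expR0.
have /andP[_ h] := exp_sum_step n; apply: (le_trans h).
have E0 : 0 <= E (exp_sum n) by apply: Rintegral_ge0 => x _; exact: expR_ge0.
rewrite big_nat_recr//= expRD [leRHS]mulrC; apply: (le_trans _ (ler_wpM2l (expR_ge0 _) ih)).
by rewrite ler_wpM2r// -addrA; exact: expR_ge1Dx.
Qed.

(** With [q] the main term and [u] the error, [expR_le1Dx] costs [2 * (q - u) ^ 2], and this is at
    most [2 * theta * (q + u)]: summed over the steps, the quadratic loss is a small multiple of the
    linear terms. *)
Lemma exp_sum_lower (theta : R) n :
  (forall k, (0 < k)%N -> 0 <= step_error k) ->
  (forall k, (0 < k)%N -> 2^-1 * b ^+ 2 * V + step_error k <= theta) ->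
  theta <= 2^-1 ->
  expR (\sum_(1 <= k < n.+1) (2^-1 * b ^+ 2 * V - step_error k
    - 2 * theta * (2^-1 * b ^+ 2 * V + step_error k))) <= E (exp_sum n).
Proof.
move=> u0 uth th; elim: n => [|n ih]; first by rewrite exp_sum0 big_geq// expR0.
have /andP[h _] := exp_sum_step n; apply: le_trans h.
rewrite big_nat_recr//= expRD mulrC; apply: le_trans (ler_wpM2l (expR_ge0 _) ih) _.
have E0 : 0 <= E (exp_sum n) by apply: Rintegral_ge0 => x _; exact: expR_ge0.
rewrite ler_wpM2r//.
have V0 : 0 <= V by apply: variance_ge0 => //; exists M.
set q := 2^-1 * b ^+ 2 * V; set u := step_error n.+1.
have q0 : 0 <= q by rewrite mulr_ge0// mulr_ge0// sqr_ge0.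
have {}u0 : 0 <= u by exact: u0.
have qu := uth n.+1 isT; rewrite -/q -/u in qu.
have xq : `|q - u| <= q + u by rewrite ler_norml; apply/andP; split; lra.
rewrite -[leRHS]addrA; apply: le_trans (expR_le1Dx _); last by lra.
have h1 : 0 <= theta * (q + u) - (q + u) * (q + u).
  by rewrite -mulrBl mulr_ge0//; lra.
have h2 : 0 <= q * u by rewrite mulr_ge0.
rewrite ler_expR -subr_ge0.
have -> : q - u - 2 * (q - u) ^+ 2 - (q - u - 2 * theta * (q + u)) =
  2 * (theta * (q + u) - (q + u) * (q + u)) + 8 * (q * u) by ring.
by rewrite addr_ge0// mulr_ge0.
Qed.

End bounded_observable.
End moment_generating_function.

(** * Asymptotics of the normalised cumulants *)

Section cumulant_limit.
Context {R : realType} {d} {Omega : measurableType d} (Pr : probability Omega R).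
Variables (X : nat -> {RV Pr >-> nat}) (mu0 : nat -> R) (Pn : nat -> nat -> nat -> R).
Hypothesis hX : is_markov_chain X mu0 Pn.
Variables (w : nat -> R) (pw : probability_vector w) (dl et : nat -> R).
Hypothesis hdl : forall k i i' (H : nat -> R) (M : R), (0 < k)%N ->
  states i -> states i' -> (forall j, `|H j| <= M) ->
  `|mean (Pn k i) H - mean (Pn k i') H| <= M * dl k.
Hypothesis het : forall k i (H : nat -> R) (M : R), (0 < k)%N ->
  states i -> (forall j, `|H j| <= M) ->
  `|mean (Pn k i) H - mean w H| <= M * et k.
Hypothesis dl_bound : forall k, (0 < k)%N -> 0 <= dl k <= 2.
Hypothesis et_bound : forall k, (0 < k)%N -> 0 <= et k <= 2.
Variable a : nat -> R.
Hypothesis dl_cvg :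
  (\sum_(1 <= k < n.+1) dl k) / Num.sqrt n%:R @[n --> \oo] --> (0 : R).
Hypothesis et_cvg : (\sum_(1 <= k < n.+1) et k) / n%:R @[n --> \oo] --> (0 : R).
Hypothesis a_gt0 : forall n, (0 < n)%N -> 0 < a n.
Hypothesis a_sqrt : a n / Num.sqrt n%:R @[n --> \oo] --> +oo.
Hypothesis a_lin : a n / n%:R @[n --> \oo] --> (0 : R).

Variables (f : nat -> R) (M : R).
Hypothesis fM : forall j, `|f j| <= M.
Let V := covar w f f.
Let M0 : 0 <= M. Proof. exact: le_trans (fM 0%N). Qed.
Let V0 : 0 <= V. Proof. by apply: variance_ge0 => //; exists M. Qed.

Let D n := \sum_(1 <= k < n.+1) dl k.
Let H n := \sum_(1 <= k < n.+1) et k.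
Let b n := a n / n%:R.
Let s n := a n ^+ 2 / n%:R.

(** The sum of [step_error] divided by the speed [s n], factored into sequences whose limits are
    assumed. *)
Let error n := M * (D n / Num.sqrt n%:R * (a n / Num.sqrt n%:R)^-1) +
  3 * M ^+ 2 * (H n / n%:R) + 8 * M ^+ 3 * b n.

Let error_cvg : error n @[n --> \oo] --> (0 : R).
Proof.
have i0 : (a n / Num.sqrt n%:R)^-1 @[n --> \oo] --> (0 : R).
  apply/gtr0_cvgV0 => //; exists 1%N => // n /= n0.
  by rewrite divr_gt0 ?a_gt0// sqrtr_gt0 ltr0n.
have -> : 0 = M * (0 * 0) + 3 * M ^+ 2 * 0 + 8 * M ^+ 3 * 0 :> R by ring.
apply: cvgD; last by apply: cvgM => //; exact: cvg_cst.
apply: cvgD; last by apply: cvgM => //; exact: cvg_cst.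
apply: cvgM; [exact: cvg_cst|exact: cvgM].
Qed.

(** The assumptions on [dl] and [et] concern averages, so a bound uniform in [k] uses only that both
    are at most 2; it still tends to 0 because every term contains a power of [b n]. *)
Let theta n := 2^-1 * b n ^+ 2 * V + (M * b n * 2 + 3 * M ^+ 2 * b n ^+ 2 * 2
   + 8 * M ^+ 3 * b n ^+ 3).

Let theta_cvg : theta n @[n --> \oo] --> (0 : R).
Proof.
have b2 : b n ^+ 2 @[n --> \oo] --> (0 : R).
  by rewrite -(mulr0 0); apply: cvgM.
have b3 : b n ^+ 3 @[n --> \oo] --> (0 : R).
  by rewrite -(mulr0 0); apply: cvgM.
have -> : 0 = 2^-1 * 0 * V + (M * 0 * 2 + 3 * M ^+ 2 * 0 * 2 + 8 * M ^+ 3 * 0) :> R by ring.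
apply: cvgD.
  by apply: cvgM; [apply: cvgM => //; exact: cvg_cst|exact: cvg_cst].
apply: cvgD; last by apply: cvgM => //; exact: cvg_cst.
by apply: cvgD; apply: cvgM; try exact: cvg_cst; apply: cvgM => //; exact: cvg_cst.
Qed.

Lemma exp_sum_asymptotics (e : R) : 0 < e -> \forall n \near \oo,
  expR (s n * (2^-1 * V - e)) <= \int[Pr]_x exp_sum X f (b n) n x <=
  expR (s n * (2^-1 * V + e)).
Proof.
move=> e0; have e4 : 0 < e / 4 by rewrite divr_gt0.
have c : 0 < (2 * M + 1)^-1 by rewrite invr_gt0 ltr_wpDl// mulr_ge0.
near=> n; have n0 : (0 < n)%N by near: n; exact: nbhs_infty_gt.
have nR0 : 0 < n%:R :> R by rewrite ltr0n.
have an0 := a_gt0 n0; have b0 : 0 < b n by rewrite divr_gt0.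
have s0 : 0 < s n by rewrite divr_gt0// exprn_gt0.
have bM : 2 * M * b n <= 1.
  have : b n <= (2 * M + 1)^-1.
    by near: n; move/cvgr_le : a_lin; exact.
  move=> h; apply: (@le_trans _ _ ((2 * M + 1) * b n)).
    by rewrite ler_wpM2r ?(ltW b0)// lerDl.
  by rewrite -ler_pdivlMl ?mulr1// -invr_gt0.
(* Budget for the lower bound: [e / 4] for [error n], [e / 2] for [theta n * V], and again at most
   [e / 4] for [2 * theta n * error n]. *)
have herr : error n <= e / 4 by near: n; move/cvgr_le : error_cvg; exact.
have th2 : theta n <= 2^-1 by near: n; move/cvgr_le : theta_cvg; apply.
have thV : theta n <= e / (2 * (V + 1)).
  near: n; move/cvgr_le : theta_cvg; apply.
  by rewrite divr_gt0// mulr_gt0// ltr_wpDl.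
have U : \sum_(1 <= k < n.+1) step_error dl et M (b n) k = s n * error n.
  rewrite /step_error !big_split/= -!mulr_sumr -/(D n) -/(H n).
  rewrite sumr_const_nat subSS subn0 -mulr_natr /error /s /b.
  have q0 : Num.sqrt n%:R != 0 :> R by rewrite gt_eqF// sqrtr_gt0.
  by field; rewrite q0 !gt_eqF.
have Q : \sum_(1 <= k < n.+1) 2^-1 * b n ^+ 2 * V = s n * (2^-1 * V).
  rewrite sumr_const_nat subSS subn0 -mulr_natr /s /b; field.
  by rewrite gt_eqF.
have u0 k : (0 < k)%N -> 0 <= step_error dl et M (b n) k.
  move=> k0; have /andP[d0 _] := dl_bound k0; have /andP[h0 _] := et_bound k0.
  move: (b n) (ltW b0) => bb bb0.
  by rewrite /step_error !addr_ge0// !mulr_ge0.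
have uth k : (0 < k)%N -> 2^-1 * b n ^+ 2 * V + step_error dl et M (b n) k <= theta n.
  move=> k0; have /andP[_ d2] := dl_bound k0; have /andP[_ h2] := et_bound k0.
  rewrite /theta; move: (b n) (ltW b0) => bb bb0.
  by rewrite /step_error lerD2l lerD2r lerD// ler_wpM2l// !mulr_ge0.
apply/andP; split; last first.
  apply: le_trans (exp_sum_upper hX pw hdl het fM b0 bM n) _.
  rewrite big_split/= Q U -mulrDr ler_expR ler_wpM2l ?(ltW s0)// lerD2l.
  lra.
apply: le_trans _ (exp_sum_lower hX pw hdl het fM b0 bM n u0 uth th2).
rewrite big_split/= big_split/= Q !sumrN U -mulr_sumr big_split/= Q U.
rewrite ler_expR.
have -> : s n * (2^-1 * V) - s n * error n -
    2 * theta n * (s n * (2^-1 * V) + s n * error n) =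
    s n * (2^-1 * V - error n - theta n * V - 2 * theta n * error n) by field.
rewrite ler_wpM2l ?(ltW s0)//.
have err0 : 0 <= error n.
  have : 0 <= s n * error n.
    by rewrite -U big_nat_cond; apply: sumr_ge0 => k /andP[/andP[k0 _] _]; exact: u0.
  by rewrite pmulr_rge0.
have h1 : theta n * V <= e / 2.
  have V1 : 0 < V + 1 by rewrite ltr_wpDl.
  apply: le_trans (ler_wpM2r V0 thV) _.
  rewrite -subr_ge0 (_ : _ - _ = e / (2 * (V + 1))); last by field; rewrite gt_eqF.
  by rewrite divr_ge0 ?(ltW e0)// mulr_ge0// ltW.
have h2 : 2 * theta n * error n <= error n.
  by rewrite ler_piMl//; lra.
lra.
Unshelve. all: by end_near. Qed.

End cumulant_limit.

(** * The limit matrix *)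

Section stochastic_matrices.
Context {R : realType}.
Implicit Types (A B : nat -> nat -> R).

Lemma stochastic_row A i : stochastic states A -> states i ->
  probability_vector (A i).
Proof. by move=> [A0 A1] si; split; [move=> j sj; exact: A0|exact: A1]. Qed.

Lemma ergodic_coef_ge A i k : states i -> states k ->
  (\esum_(j in states) (Num.max 0 (A i j - A k j))%:E <= ergodic_coef states A)%E.
Proof.
by move=> si sk; apply: ereal_sup_ubound; exists i => //; exists k.
Qed.

Lemma ergodic_coef_bound A : stochastic states A ->
  (0 <= ergodic_coef states A <= 1)%E.
Proof.
move=> sA; have s1 : states 1%N by [].
apply/andP; split.
  apply: le_trans (ergodic_coef_ge A s1 s1); apply: esum_ge0 => j _.
  by rewrite lee_fin le_max lexx.
apply: ge_ereal_sup => _ [i si [k sk <-]].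
have [A0 A1] := sA; rewrite -(A1 i si); apply: le_esum => j sj.
by rewrite lee_fin ge_max A0//= gerBl A0.
Qed.

Lemma ergodic_coef_fin A : stochastic states A ->
  ergodic_coef states A \is a fin_num.
Proof.
move=> /ergodic_coef_bound/andP[h0 h1].
by rewrite ge0_fin_numE// (le_lt_trans h1)// ltry.
Qed.

(** The absolute value is the sum of the positive parts of a number and of its opposite; exchanging
    the two rows bounds both by the same coefficient. *)
Lemma ergodic_coef_sum A i k n : stochastic states A -> states i -> states k ->
  \sum_(0 <= j < n | j \in states) `|A i j - A k j| <=
  2 * fine (ergodic_coef states A).
Proof.
move=> sA si sk; have ef := ergodic_coef_fin sA.
have h (i' k' : nat) : states i' -> states k' ->
    \sum_(0 <= j < n | j \in states) Num.max 0 (A i' j - A k' j) <=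
    fine (ergodic_coef states A).
  move=> si' sk'; rewrite -lee_fin fineK//.
  apply: le_trans (ergodic_coef_ge A si' sk').
  have E (j : nat) : Num.max 0 (A i' j - A k' j) = `|Num.max 0 (A i' j - A k' j)|.
    by rewrite ger0_norm// le_max lexx.
  rewrite (eq_bigr _ (fun j _ => E j)).
  apply: le_trans (esum_partial_sum _ n) _.
  by apply: le_esum => j _; rewrite -E.
have -> : \sum_(0 <= j < n | j \in states) `|A i j - A k j| =
    \sum_(0 <= j < n | j \in states) Num.max 0 (A i j - A k j) +
    \sum_(0 <= j < n | j \in states) Num.max 0 (A k j - A i j).
  rewrite -big_split/=; apply: eq_bigr => j _.
  have [h'|h'] := leP (A i j) (A k j).
    rewrite max_l ?subr_le0// max_r ?subr_ge0// add0r ler0_norm ?subr_le0//.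
    by rewrite opprB.
  by rewrite max_r ?subr_ge0 ?ltW// max_l ?subr_le0 ?ltW// addr0 ger0_norm// subr_ge0 ltW.
by rewrite mulr2n mulrDl mul1r lerD// h.
Qed.

Lemma mnorm_ge A i : states i ->
  (\esum_(j in states) `|A i j|%:E <= mnorm states A)%E.
Proof. by move=> si; apply: ereal_sup_ubound; exists i. Qed.

Lemma mnorm_ge0 A : (0 <= mnorm states A)%E.
Proof.
have s1 : states 1%N by [].
by apply: le_trans (mnorm_ge A s1); apply: esum_ge0 => j _; rewrite lee_fin.
Qed.

Lemma mnorm_bound A B : stochastic states A -> stochastic states B ->
  (mnorm states (fun i j => (A i j - B i j)%R) <= 2%:E)%E.
Proof.
move=> [A0 A1] [B0 B1]; apply: ge_ereal_sup => _ [i si <-].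
have -> : (2%:E = \esum_(j in states) (A i j)%:E + \esum_(j in states) (B i j)%:E)%E.
  by rewrite A1// B1.
rewrite -esumD; last 2 first.
- by move=> j sj; rewrite lee_fin A0.
- by move=> j sj; rewrite lee_fin B0.
apply: le_esum => j sj; rewrite -EFinD lee_fin (le_trans (ler_normB _ _))//.
by rewrite !ger0_norm// ?A0 ?B0.
Qed.

Lemma mnorm_fin A B : stochastic states A -> stochastic states B ->
  mnorm states (fun i j => (A i j - B i j)%R) \is a fin_num.
Proof.
move=> sA sB.
by rewrite ge0_fin_numE ?mnorm_ge0// (le_lt_trans (mnorm_bound sA sB))// ltry.
Qed.

Lemma mnorm_sum A B i n : stochastic states A -> stochastic states B -> states i ->
  \sum_(0 <= j < n | j \in states) `|A i j - B i j| <=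
  fine (mnorm states (fun i j => A i j - B i j)).
Proof.
move=> sA sB si; rewrite -lee_fin fineK ?mnorm_fin//.
exact: le_trans (esum_partial_sum _ n) (mnorm_ge _ si).
Qed.

Lemma le_partial_sum (u : nat -> R) (j : nat) (C : R) : states j ->
  (forall n, \sum_(0 <= k < n | k \in states) `|u k| <= C) -> `|u j| <= C.
Proof.
move=> sj /(_ j.+1); apply: le_trans.
by rewrite big_mkcond big_nat_recr//= mem_set// lerDr sumr_ge0// => k _; case: ifP.
Qed.

(** When the rows agree, the stationarity equation at [j] averages a constant against a probability
    vector. *)
Lemma stationary_const_rows A p : stochastic states A -> stationary states A p ->
  (forall i i' j, states i -> states i' -> states j -> A i j = A i' j) ->
  forall i j, states i -> states j -> A i j = p j.
Proof.
move=> sA [p0 p1 pA] rows i j si sj; have [A0 _] := sA.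
have pv : probability_vector p by split.
have c1 : \sum_(0 <= k < n | k \in states) p k * A k j @[n --> \oo] --> p j.
  by apply: esum_partial_cvg; [move=> k sk; rewrite mulr_ge0 ?p0 ?A0|exact: pA].
have c2 : \sum_(0 <= k < n | k \in states) p k * A k j @[n --> \oo] --> (1 * A i j : R).
  have c3 : (\sum_(0 <= k < n | k \in states) p k) * A i j @[n --> \oo] -->
    (1 * A i j : R).
    by apply: cvgM; [exact: probability_vector_cvg|exact: cvg_cst].
  apply: (eq_cvg_to _ c3) => n; rewrite mulr_suml; apply: eq_bigr => k /set_mem sk.
  by rewrite (rows k i j).
by have := cvg_unique _ c1 c2; rewrite mul1r => ->.
Qed.

End stochastic_matrices.

Lemma eq_charge d (T : measurableType d) (R : realType)
  (m1 m2 : {charge set T -> \bar R}) :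
  m1 = m2 :> (set T -> \bar R) -> m1 = m2.
Proof.
move: m1 m2 => [m1 [[sa1] [ad1] [fi1]]] [m2 [[+] [+] [+]]] /= m12.
rewrite -{}m12 => sa2 ad2 fi2.
by rewrite (_ : sa2 = sa1)// (_ : ad2 = ad1)// (_ : fi2 = fi1).
Qed.

(** * The centred empirical measure as a random charge *)

Section empirical_pairing.
Context {R : realType} {d} {Omega : measurableType d} (Pr : probability Omega R).
Variables (X : nat -> {RV Pr >-> nat}) (a : nat -> R).

Definition centered_empirical n (x : Omega) : tau_topology R :=
  cadd (empirical a (fun k => X k x) n) (copp (mean_empirical X a n)).

Definition centered_sum n (f : R -> R) (x : Omega) : R :=
  (a n)^-1 * \sum_(1 <= k < n.+1)
    (f (X k x)%:R - state_mean X (fun i => f i%:R) k).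

Lemma bounded_measurable_comp k (f : R -> R) : bounded_measurable f ->
  bounded_measurable (fun x => f (X k x)%:R).
Proof.
by move=> [_ [M fM]]; apply: (bounded_measurable_state X k (H := fun i => f i%:R) (M := M)).
Qed.

Lemma centered_sum_bounded_linear n x : bounded_linear (fun f => centered_sum n f x).
Proof.
have lin := Rintegral_bounded_linear Pr; split.
  move=> c f g bf bg; rewrite /centered_sum mulrCA -mulrDr; congr (_ * _).
  rewrite mulr_sumr -big_split/=; apply: eq_bigr => k _; rewrite /state_mean.
  rewrite lin.1; [ring|exact: bounded_measurable_comp..].
exists (`|(a n)^-1| * (\sum_(1 <= k < n.+1) 2)) => f M bf fM.
rewrite /centered_sum normrM -mulrA ler_wpM2l//.
rewrite (le_trans (ler_norm_sum _ _ _))// mulr_suml; apply: ler_sum => k _.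
rewrite (le_trans (ler_normB _ _))// mulr2n mulrDl mul1r lerD//.
by apply: state_mean_norm.
Qed.

(** Both sides are bounded linear in [f], so indicators suffice and the Jordan decomposition of the
    difference never has to be computed. *)
Lemma pairing_centered_empirical n x (f : R -> R) : bounded_measurable f ->
  pairing f (centered_empirical n x) = centered_sum n f x.
Proof.
apply: (@bounded_linear_ext _ _ _ (pairing^~ _) (fun f => centered_sum n f x)).
- exact: pairing_bounded_linear.
- exact: centered_sum_bounded_linear.
move=> A mA; have lin := Rintegral_bounded_linear Pr.
have bI k : bounded_measurable (fun y => \1_A (X k y)%:R : R).
  by apply: bounded_measurable_comp; exact: bounded_measurable_indic.
have eE y : fine (empirical a (fun k => X k y) n A) =
    (a n)^-1 * \sum_(1 <= k < n.+1) \1_A (X k y)%:R.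
  by rewrite /empirical /dirac sumEFin -EFinM.
rewrite pairing_indic// /centered_empirical /cadd/= /copp/=.
rewrite fineD ?fin_numN ?fin_num_measure// fineN eE.
have -> : fine (mean_empirical X a n A) =
    (a n)^-1 * \sum_(1 <= k < n.+1) state_mean X (fun i => \1_A i%:R) k.
  rewrite /mean_empirical unlock -/(Rintegral Pr setT _).
  under eq_Rintegral do rewrite eE.
  rewrite (bounded_linearZ lin); last exact: bounded_measurable_sum.
  by rewrite (bounded_linear_sum lin).
by rewrite -mulrBr -sumrB.
Qed.

Lemma centered_empirical_past n x x' : (forall k, (k <= n)%N -> X k x = X k x') ->
  centered_empirical n x = centered_empirical n x'.
Proof.
move=> h; apply: eq_charge; apply/funext => B; rewrite /cadd/=; congr (_ + _)%E.
rewrite /empirical; congr (_ * _)%E; apply: eq_big_nat => k.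
by rewrite ltnS => /andP[_ kn]; rewrite h.
Qed.

(** The charge is a function of the history, so the event is the preimage under [path_code] of its
    own image, and every preimage under [path_code] is measurable. *)
Lemma measurable_centered_empirical n (A : set (tau_topology R)) :
  measurable [set x | A (centered_empirical n x)].
Proof.
pose N := path_code X n.
have -> : [set x | A (centered_empirical n x)] =
    N @^-1` (N @` [set x | A (centered_empirical n x)]).
  apply/seteqP; split => [x Ax|x [x' /= Ax' /path_codeP h]]; first by exists x.
  by rewrite -(centered_empirical_past h).
exact: measurable_path_code.
Qed.

End empirical_pairing.

Lemma rate_function_const_rows {R : realType} (P : nat -> nat -> R) (p : nat -> R) :
  probability_vector p ->
  (forall i j, states i -> states j -> P i j = p j) ->
  rate_function P p = legendre p.
Proof.
move=> pp Pp; apply/funext => nu; rewrite /rate_function /legendre.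
congr ereal_sup; apply: eq_imagel => f _; congr (_ - _)%:E; rewrite /cumulant.
congr (_ * _); have [M hM] := bounded_measurable_nat (bounded_borel_measurable f).
pose F i := sval f i%:R; have bF : nbounded F by exists M.
have rowE i : states i -> rsum states (fun j => sval f j%:R * P i j) = mean p F.
  by move=> si; apply: eq_rsum => j sj; rewrite Pp// mulrC.
transitivity (mean p (fun i => 1 * (F i * F i) + - (mean p F) ^+ 2)).
  by apply: eq_rsum => i si; rewrite rowE// mul1r -expr2.
rewrite meanP//; [|exact: nboundedM|by exists `|- mean p F ^+ 2|].
by rewrite mean_cst// mul1r /covar -expr2.
Qed.

(** * From the assumptions on the transition matrices to the rows of the limit *)

Section reduction.
Context {R : realType} (Pn : nat -> nat -> nat -> R) (P : nat -> nat -> R)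
  (pi : nat -> R) (a : nat -> R).
Hypothesis sPn : forall n, (0 < n)%N -> stochastic states (Pn n).
Hypothesis sP : stochastic states P.
Hypothesis hpi : stationary states P pi.
Hypothesis hPn : ereal_sup (range (fun m : nat => ((n%:R)^-1)%:E *
              \sum_(1 <= k < n.+1)
                 mnorm states (fun i j => (Pn (k + m)%N i j - P i j)%R))%E)
           @[n --> \oo] --> 0%E.
Hypothesis hdelta : ((\sum_(1 <= k < n.+1) ergodic_coef states (Pn k)) *
               ((Num.sqrt n%:R)^-1)%:E)%E @[n --> \oo] --> 0%E.
Hypothesis a_gt0 : forall n, (0 < n)%N -> 0 < a n.
Hypothesis a_sqrt : a n / Num.sqrt n%:R @[n --> \oo] --> +oo.
Hypothesis a_lin : a n / n%:R @[n --> \oo] --> 0.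

Definition ergodicity_defect k : R := 2 * fine (ergodic_coef states (Pn k)).
Definition distance_to_limit k : R :=
  fine (mnorm states (fun i j => Pn k i j - P i j)).

Lemma ergodicity_defect_bound k : (0 < k)%N -> 0 <= ergodicity_defect k <= 2.
Proof.
move=> k0; have /andP[h0 h1] := ergodic_coef_bound (sPn k0).
have ef := ergodic_coef_fin (sPn k0); rewrite /ergodicity_defect.
have f1 : fine (ergodic_coef states (Pn k)) <= 1 by rewrite -lee_fin fineK.
have f0 : 0 <= fine (ergodic_coef states (Pn k)) by exact: fine_ge0.
by apply/andP; split; lra.
Qed.

Lemma distance_to_limit_bound k : (0 < k)%N -> 0 <= distance_to_limit k <= 2.
Proof.
move=> k0; rewrite /distance_to_limit fine_ge0 ?mnorm_ge0//=.
by rewrite -lee_fin fineK ?mnorm_fin ?mnorm_bound//; exact: sPn.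
Qed.

Lemma ergodicity_defect_cvg :
  (\sum_(1 <= k < n.+1) ergodicity_defect k) / Num.sqrt n%:R @[n --> \oo] --> (0 : R).
Proof.
have : (\sum_(1 <= k < n.+1) fine (ergodic_coef states (Pn k))) / Num.sqrt n%:R
    @[n --> \oo] --> (0 : R).
  suff : ((\sum_(1 <= k < n.+1) fine (ergodic_coef states (Pn k))) /
      Num.sqrt n%:R)%:E @[n --> \oo] --> (0%:E : \bar R) by move=> /fine_cvgP[].
  move: hdelta; apply: cvg_trans; apply: near_eq_cvg; apply: nearW => n.
  rewrite EFinM -sumEFin; congr (_ * _)%E; apply: eq_big_nat => k /andP[k0 _].
  by rewrite fineK// ergodic_coef_fin//; exact: sPn.
move=> h; have h2 : 2 * ((\sum_(1 <= k < n.+1) fine (ergodic_coef states (Pn k))) /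
    Num.sqrt n%:R) @[n --> \oo] --> (2 * 0 : R) by apply: cvgM => //; exact: cvg_cst.
rewrite mulr0 in h2; apply: (eq_cvg_to _ h2) => n.
by rewrite /ergodicity_defect -mulr_sumr mulrA.
Qed.

Lemma distance_to_limit_cvg :
  (\sum_(1 <= k < n.+1) distance_to_limit k) / n%:R @[n --> \oo] --> (0 : R).
Proof.
suff : ((\sum_(1 <= k < n.+1) distance_to_limit k) / n%:R)%:E @[n --> \oo] -->
    (0%:E : \bar R) by move=> /fine_cvgP[].
apply: squeeze_cvge hPn; last exact: cvg_cst.
apply: nearW => n; apply/andP; split.
  rewrite lee_fin divr_ge0// big_nat_cond sumr_ge0// => k /andP[/andP[k0 _] _].
  by have /andP[] := distance_to_limit_bound k0.
(* The shift [m = 0] in the supremum. *)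
apply: ereal_sup_ubound; exists 0%N => //.
rewrite mulrC EFinM -sumEFin; congr (_ * _)%E; apply: eq_big_nat => k /andP[k0 _].
by rewrite addn0 fineK// mnorm_fin//; exact: sPn.
Qed.

(* The distance between two rows is at most [defect k + 2 * distance k] for
   every [k], and the averages of this bound tend to 0. *)
Lemma limit_const_rows i i' j : states i -> states i' -> states j ->
  P i j = P i' j.
Proof.
move=> si si' sj; apply/eqP; rewrite -subr_eq0 -normr_le0.
have bnd k : (0 < k)%N -> `|P i j - P i' j| <=
    ergodicity_defect k + 2 * distance_to_limit k.
  move=> k0; have h1 : `|Pn k i j - Pn k i' j| <= ergodicity_defect k.
    by apply: (le_partial_sum (u := fun j => Pn k i j - Pn k i' j) sj) => n;
      apply: ergodic_coef_sum => //; exact: sPn.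
  have h2 i0 : states i0 -> `|Pn k i0 j - P i0 j| <= distance_to_limit k.
    by move=> s0; apply: (le_partial_sum (u := fun j => Pn k i0 j - P i0 j) sj) => n;
      apply: mnorm_sum => //; exact: sPn.
  have := h2 _ si; have := h2 _ si'; move: h1.
  rewrite !ler_norml => /andP[? ?] /andP[? ?] /andP[? ?].
  by apply/andP; split; lra.
(* The factor after the first quotient equals the inverse of [Num.sqrt n%:R]; writing it through
   [a n] lets its limit follow from [a_sqrt] and [a_lin]. *)
have cv : (\sum_(1 <= k < n.+1) ergodicity_defect k) / Num.sqrt n%:R *
    ((a n / Num.sqrt n%:R)^-1 * (a n / n%:R)) +
    2 * ((\sum_(1 <= k < n.+1) distance_to_limit k) / n%:R) @[n --> \oo] -->
    (0 * (0 * 0) + 2 * 0 : R).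
  apply: cvgD.
    apply: cvgM; first exact: ergodicity_defect_cvg.
    apply: cvgM => //; apply/gtr0_cvgV0 => //; exists 1%N => // n /= n0.
    by rewrite divr_gt0 ?a_gt0// sqrtr_gt0 ltr0n.
  by apply: cvgM; [exact: cvg_cst|exact: distance_to_limit_cvg].
rewrite !mul0r mulr0 add0r in cv.
rewrite -[leRHS](cvg_lim (@Rhausdorff R) cv).
apply: limr_ge; first by apply/cvg_ex; exists 0.
exists 1%N => // n /= n0.
have nR0 : 0 < n%:R :> R by rewrite ltr0n.
have an0 := a_gt0 n0.
have q0 : 0 < Num.sqrt n%:R :> R by rewrite sqrtr_gt0.
have -> : (\sum_(1 <= k < n.+1) ergodicity_defect k) / Num.sqrt n%:R *
    ((a n / Num.sqrt n%:R)^-1 * (a n / n%:R)) +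
    2 * ((\sum_(1 <= k < n.+1) distance_to_limit k) / n%:R) =
  (\sum_(1 <= k < n.+1) (ergodicity_defect k + 2 * distance_to_limit k)) / n%:R.
  have -> : \sum_(1 <= k < n.+1) (ergodicity_defect k + 2 * distance_to_limit k) =
    \sum_(1 <= k < n.+1) ergodicity_defect k +
    2 * \sum_(1 <= k < n.+1) distance_to_limit k by rewrite big_split/= mulr_sumr.
  by field; rewrite !gt_eqF.
rewrite ler_pdivlMr// mulr_natr -[X in _ *+ X](subn0 n) -(subSS 0 n) -sumr_const_nat.
by apply: ler_sum_nat => k /andP[k0 _]; exact: bnd.
Qed.

Lemma limit_rows i j : states i -> states j -> P i j = pi j.
Proof. exact: (stationary_const_rows sP hpi limit_const_rows). Qed.

End reduction.

Theorem theorem1p4 (R : realType) (d : measure_display)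
    (Omega : measurableType d) (Pr : probability Omega R)
    (X : nat -> {RV Pr >-> nat}) (mu0 : nat -> R)
    (Pn : nat -> nat -> nat -> R) (P : nat -> nat -> R) (pi : nat -> R)
    (a : nat -> R)
    (hX : is_markov_chain X mu0 Pn)
    (hP : stochastic states P)
    (hPe : periodic_strongly_ergodic states P)
    (hpi : stationary states P pi)
    (hPn : ereal_sup (range (fun m : nat => ((n%:R)^-1)%:E *
              \sum_(1 <= k < n.+1)
                 mnorm states (fun i j => (Pn (k + m)%N i j - P i j)%R))%E)
           @[n --> \oo] --> 0%E)
    (hdelta : ((\sum_(1 <= k < n.+1) ergodic_coef states (Pn k)) *
               ((Num.sqrt n%:R)^-1)%:E)%E @[n --> \oo] --> 0%E)
    (ha : forall n : nat, (0 < n)%N -> 0 < a n)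
    (ha_sqrt : a n / Num.sqrt n%:R @[n --> \oo] --> +oo)
    (ha_lin : a n / n%:R @[n --> \oo] --> 0) :
  satisfies_mdp (deviation_prob X a) (fun n => a n ^+ 2 / n%:R)
    (rate_function P pi).
Proof.
have [_ _ sPn _ _] := hX.
have ppi : probability_vector pi by have [p0 p1 _] := hpi; split.
have rows := limit_rows sPn hP hpi hPn hdelta ha ha_sqrt ha_lin.
rewrite (rate_function_const_rows ppi rows).
apply: (@mdp_of_cumulants _ _ _ _ _ ppi (centered_empirical X a)).
- by move=> n A; exact: measurable_centered_empirical.
- move=> n f bf.
  have -> : (fun x => pairing f (centered_empirical X a n x)) = centered_sum X a n f.
    by apply/funext => x; rewrite pairing_centered_empirical.
  rewrite /centered_sum; apply: bounded_measurableZ.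
  apply: (bounded_measurable_sum _ (F := fun k x =>
    f (X k x)%:R - state_mean X (fun i => f i%:R) k)) => k.
  apply: bounded_measurableD; first exact: (bounded_measurable_comp X k bf).
  exact: bounded_measurable_cst.
- apply/cvgryPge => A; near=> n.
  have n0 : (0 < n)%N by near: n; exact: nbhs_infty_gt.
  have r1 : 1 <= a n / Num.sqrt n%:R by near: n; move/cvgryPge : ha_sqrt; exact.
  have rA : A <= a n / Num.sqrt n%:R by near: n; move/cvgryPge : ha_sqrt; exact.
  (* The speed is the square of a sequence tending to infinity, and a square dominates its root once
     the root is at least 1. *)
  have -> : a n ^+ 2 / n%:R = (a n / Num.sqrt n%:R) * (a n / Num.sqrt n%:R).
    by rewrite mulrACA -invfM -!expr2 sqr_sqrtr ?ler0n.
  by apply: (le_trans rA); rewrite ler_peMr// (le_trans ler01).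
move=> f e bf e0.
have [_ [M fM]] := bf.
pose F i := f i%:R; have FM j : `|F j| <= M by exact: fM.
have hdl k i i' (H : nat -> R) (N : R) : (0 < k)%N -> states i -> states i' ->
    (forall j, `|H j| <= N) ->
    `|mean (Pn k i) H - mean (Pn k i') H| <= N * ergodicity_defect Pn k.
  move=> k0 si si' HN; apply: mean_diff => //.
  - exact: stochastic_row (sPn _ k0) si.
  - exact: stochastic_row (sPn _ k0) si'.
  - by move=> n; apply: ergodic_coef_sum => //; exact: sPn.
have het k i (H : nat -> R) (N : R) : (0 < k)%N -> states i ->
    (forall j, `|H j| <= N) ->
    `|mean (Pn k i) H - mean pi H| <= N * distance_to_limit Pn P k.
  move=> k0 si HN; apply: mean_diff => //.
  - exact: stochastic_row (sPn _ k0) si.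
  - move=> n; rewrite (eq_bigr (fun j => `|Pn k i j - P i j|)).
      by apply: mnorm_sum => //; exact: sPn.
    by move=> j /set_mem sj; rewrite (rows i j).
have := exp_sum_asymptotics hX ppi hdl het (ergodicity_defect_bound sPn)
  (distance_to_limit_bound sPn hP) (ergodicity_defect_cvg sPn hdelta)
  (distance_to_limit_cvg sPn hP hPn) ha ha_sqrt ha_lin FM e0.
move=> /(filterI (nbhs_infty_gt 0)); apply: filterS => n [n0].
rewrite /cumulant -/F.
(* The tilt [b = a n / n] of the raw centred sum is the speed times the factor [1 / a n] of the
   empirical measure. *)
have -> // : \int[Pr]_x exp_sum X F (a n / n%:R) n x =
  \int[Pr]_x expR (a n ^+ 2 / n%:R * pairing f (centered_empirical X a n x)).
apply: eq_Rintegral => x _; rewrite pairing_centered_empirical// /exp_sum /centered_sum.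
congr expR; rewrite mulrA; congr (_ * _).
by field; rewrite !gt_eqF ?ltr0n ?ha.
Unshelve. all: by end_near. Qed.
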